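(* Let $a<b$ and $\bar\varepsilon>0$, and for every $\varepsilon\in[-\bar\varepsilon,\bar\varepsilon]$ let $M_\varepsilon\colon\mathbb{R}\times[a,b]\to\mathbb{R}^2$ be a one-to-one map of class $\mathcal{C}^4$ of the form $$M_\varepsilon(\theta,r)=\bigl(\theta+\alpha(r)+\mu_1(\theta,r;\varepsilon),\;r+\mu_2(\theta,r;\varepsilon)\bigr),$$ where $\alpha\colon[a,b]\to\mathbb{R}$, the functions $\mu_1,\mu_2$ are $2\pi$-periodic in $\theta$ and satisfy $\mu_1(\theta,r;0)=\mu_2(\theta,r;0)=0$. Assume that each $M_\varepsilon$ is exact symplectic, i.e. there exists a function $V_\varepsilon\colon\mathbb{R}\times[a,b]\to\mathbb{R}$ of class $\mathcal{C}^4$, $2\pi$-periodic in $\theta$, with $\mathrm{d}V_\varepsilon=M_\varepsilon^*\lambda-\lambda$, where $\lambda=r\,\mathrm{d}\theta$. Assume moreover that $$\|\mu_1(\cdot,\cdot;\varepsilon)\|_{\mathcal{C}^4}+\|\mu_2(\cdot,\cdot;\varepsilon)\|_{\mathcal{C}^4}\to0\quad\text{as }\varepsilon\to0.$$ Suppose that for some $r^*\in(a,b)$ there is a pair of coprime integers $(n_1,n_2)\in(\mathbb{N}\setminus\{0\})\times\mathbb{Z}$ with $\alpha(r^* )=2\pi n_2/n_1$, and that $\alpha'(r^* )\neq0$. Then there exist $\varepsilon^*>0$ and $\delta^*>0$ such that, for every pair of coprime integers $(m_1,m_2)\in(\mathbb{N}\setminus\{0\})\times\mathbb{Z}$ with $\left|\frac{m_2}{m_1}-\frac{n_2}{n_1}\right|<\delta^*$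 and every $\varepsilon$ with $|\varepsilon|<\varepsilon^*$, the map $M_\varepsilon$ has at least two distinct $(m_1,m_2)$-periodic points.
   Context: For $(m_1,m_2)\in(\mathbb{N}\setminus\{0\})\times\mathbb{Z}$, a point $(\bar\theta,\bar r)$ is an $(m_1,m_2)$-periodic point of $M_\varepsilon$ if the iterates $M_\varepsilon^j(\bar\theta,\bar r)$ are defined (i.e. all previous iterates lie in $\mathbb{R}\times[a,b]$) for $j=1,\dots,m_1$ and $M_\varepsilon^{m_1}(\bar\theta,\bar r)=(\bar\theta+2\pi m_2,\bar r)$. Two $(m_1,m_2)$-periodic points $(\bar\theta_1,\bar r_1)$, $(\bar\theta_2,\bar r_2)$ are called distinct if $M_\varepsilon^j(\bar\theta_1,\bar r_1)-(\bar\theta_2,\bar r_2)\notin2\pi\mathbb{Z}\times\{0\}$ for every $j\in\{0,1,\dots,m_1-1\}$ (with $M_\varepsilon^0$ the identity), i.e. they do not belong to the same periodicity class up to translations of $\theta$ by multiples of $2\pi$. *)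

(* Defs.v *)
From Stdlib Require Import Reals Lra ZArith List.
From Coquelicot Require Import Coquelicot.
Open Scope R_scope.

Definition in_strip (a b : R) (p : R * R) : Prop := a <= snd p <= b.
Definition in_open_strip (a b : R) (p : R * R) : Prop := a < snd p < b.

Definition pdir (d : bool) (f : R -> R -> R) : R -> R -> R :=
  if d then fun t r => Derive (fun r' => f t r') r
  else fun t r => Derive (fun t' => f t' r) t.

Fixpoint pd (w : list bool) (f : R -> R -> R) : R -> R -> R :=
  match w with
  | nil => f
  | d :: w' => pdir d (pd w' f)
  end.

Definition uncurry2 (f : R -> R -> R) : R * R -> R := fun q => f (fst q) (snd q).

(* f is of class C^k on the closed strip R x [a,b]: all partial derivatives
   of order <= k exist and are continuous in the interior R x (a,b), and
   each of them extends continuously to the closed strip (for order 0 the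
   extension is f itself, i.e. f is continuous on the closed strip). *)
Definition Ck_strip (k : nat) (a b : R) (f : R -> R -> R) : Prop :=
  (forall (w : list bool) (d : bool), (length w < k)%nat ->
     forall p, in_open_strip a b p ->
       if d then ex_derive (fun r' => pd w f (fst p) r') (snd p)
       else ex_derive (fun t' => pd w f t' (snd p)) (fst p))
  /\
  (forall w : list bool, (length w <= k)%nat ->
     exists g : R * R -> R,
       (forall p, in_open_strip a b p -> g p = uncurry2 (pd w f) p) /\
       (w = nil -> forall p, in_strip a b p -> g p = uncurry2 f p) /\
       (forall p, in_strip a b p ->
          filterlim g (within (in_strip a b) (locally p)) (locally (g p)))).

Definition Ck_norm (k : nat) (a b : R) (f : R -> R -> R) : Rbar :=
  Lub_Rbar (fun y => exists (w : list bool) (p : R * R),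
    (length w <= k)%nat /\ in_open_strip a b p /\ y = Rabs (uncurry2 (pd w f) p)).

Definition Mmap (alpha : R -> R) (mu1 mu2 : R -> R -> R -> R) (eps : R)
  (p : R * R) : R * R :=
  (fst p + alpha (snd p) + mu1 eps (fst p) (snd p), snd p + mu2 eps (fst p) (snd p)).

Fixpoint iter_map (M : R * R -> R * R) (j : nat) (p : R * R) : R * R :=
  match j with
  | O => p
  | S j' => M (iter_map M j' p)
  end.

(* (m1,m2)-periodic point: iterates M^1..M^m1 defined (all previous iterates
   in the strip) and M^m1 p = (theta + 2 pi m2, r). *)
Definition periodic_point (a b : R) (M : R * R -> R * R) (m1 : nat) (m2 : Z)
  (p : R * R) : Prop :=
  in_strip a b p /\
  (forall j : nat, (j < m1)%nat -> in_strip a b (iter_map M j p)) /\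
  iter_map M m1 p = (fst p + 2 * PI * IZR m2, snd p).

(* distinct periodicity classes up to 2 pi translations in theta *)
Definition distinct_periodic (M : R * R -> R * R) (m1 : nat) (p q : R * R) : Prop :=
  forall j : nat, (j < m1)%nat ->
    ~ (exists k : Z, fst (iter_map M j p) - fst q = 2 * PI * IZR k /\
                     snd (iter_map M j p) - snd q = 0).

(* Main.v *)
Require Import Defs.
From Stdlib Require Import Reals ZArith List Lra Lia Psatz.
From Stdlib Require Import Classical ClassicalEpsilon FunctionalExtensionality.
From Coquelicot Require Import Coquelicot.
Open Scope R_scope.

(** The proof is variational, which makes it uniform in the period. On a strip around [rstar]
    the map is a twist map; after a reflection [r -> - r] the twist is positive, and the map has
    a generating function, which is continued to all pairs of angles with nonpositive mixed
    derivative. For the resulting action on configurations of rotation type (m1, m2) the explicit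
    gradient step with a small step size preserves the order, hence preserves monotone
    configurations. A minimizer of the action among these is a critical point, and a minimax
    between the minimizer and its next translate gives a second critical point lying between the
    two; coprimality of (m1, m2) shows that it is not a translate of the first. Finally, along a
    critical configuration the momentum drifts slowly, while monotonicity keeps the mean angular
    speed near 2 pi m2 / m1; so the momentum stays near [rstar], where the continuation
    agrees with the original map. *)

(** * Finite sums and subsequences *)

(** The thresholds must be fixed before m1 and m2, so the m1-th iterate cannot be treated as a
    perturbation: the error would grow with m1. Uniformity comes from order alone. In a monotone
    configuration [u (q + n) - u q] stays within 2 PI of 2 PI n / m1, whatever m1 and n are, so the
    step size, the drift estimate and the number of steps in the confinement argument depend only on
    alpha near [rstar]. The other obstacle is that the map lives on a strip. A generating function
    is given a priori only for pairs of angles joined by one iterate, and a critical configuration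
    might contain other pairs. The continuation measures by an excess how far the final angle lies
    beyond the image; at the edge of the image its first derivatives are only Lipschitz. Hence the
    descent is a discrete step estimated by finite differences, and the sign of the mixed derivative
    is expressed as monotonicity of the first derivatives. *)

Lemma Zperiodic_mul {T : Type} (f : Z -> T) (n : Z) :
  (forall q, f (q + n)%Z = f q) -> forall k q, f (q + k * n)%Z = f q.
Proof.
intros H k; induction k as [|k IH|k IH] using Z.peano_ind; intros q.
- f_equal; lia.
- rewrite <- (IH q), <- (H (q + k * n)%Z). f_equal; lia.
- rewrite <- (IH q), <- (H (q + Z.pred k * n)%Z). f_equal; lia.
Qed.

Fixpoint zsum (f : Z -> R) (n : nat) : R :=
  match n with
  | O => 0
  | S k => zsum f k + f (Z.of_nat k)
  end.

Lemma zsum_ext (f g : Z -> R) n : (forall q, f q = g q) -> zsum f n = zsum g n.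
Proof. intros E; induction n as [|n IH]; simpl; [easy|]. now rewrite IH, E. Qed.

Lemma zsum_plus (f g : Z -> R) n :
  zsum (fun q => f q + g q) n = zsum f n + zsum g n.
Proof. induction n as [|n IH]; simpl; [lra|]. rewrite IH; ring. Qed.

Lemma zsum_scal (c : R) (f : Z -> R) n : zsum (fun q => c * f q) n = c * zsum f n.
Proof. induction n as [|n IH]; simpl; [lra|]. rewrite IH; ring. Qed.

Lemma zsum_le (f g : Z -> R) n : (forall q, f q <= g q) -> zsum f n <= zsum g n.
Proof.
intros E; induction n as [|n IH]; simpl; [lra|].
specialize (E (Z.of_nat n)); lra.
Qed.

Lemma zsum_ge0 (f : Z -> R) n : (forall q, 0 <= f q) -> 0 <= zsum f n.
Proof.
intros E; induction n as [|n IH]; simpl; [lra|].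
specialize (E (Z.of_nat n)); lra.
Qed.

Lemma zsum_term_le (f : Z -> R) n q :
  (forall p, 0 <= f p) -> (0 <= q < Z.of_nat n)%Z -> f q <= zsum f n.
Proof.
intros E; induction n as [|n IH]; intros Hq; [lia|]; simpl.
pose proof (zsum_ge0 f n E) as P.
destruct (Z.eq_dec q (Z.of_nat n)) as [->|N]; [lra|].
assert (f q <= zsum f n) by (apply IH; lia).
specialize (E (Z.of_nat n)); lra.
Qed.

Lemma zsum_Rabs_le (f : Z -> R) n (c : R) :
  (forall q, Rabs (f q) <= c) -> Rabs (zsum f n) <= INR n * c.
Proof.
intros E; induction n as [|n IH]; [simpl; rewrite Rabs_R0; lra|].
rewrite S_INR; simpl.
pose proof (Rabs_triang (zsum f n) (f (Z.of_nat n))).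
specialize (E (Z.of_nat n)); lra.
Qed.

Lemma zsum_succ (f : Z -> R) n :
  zsum (fun q => f (q + 1)%Z) n = zsum f n + f (Z.of_nat n) - f 0%Z.
Proof.
induction n as [|n IH]; simpl; [lra|].
rewrite IH.
replace (Z.of_nat n + 1)%Z with (Z.of_nat (S n)) by lia.
change (Z.pos (Pos.of_succ_nat n)) with (Z.of_nat (S n)); ring.
Qed.

(** Shifting the window by one index exchanges [f 0] for [f n], which are equal; every other shift,
    of either sign, follows by induction. *)
Lemma zsum_shift (f : Z -> R) n :
  (forall q, f (q + Z.of_nat n)%Z = f q) ->
  forall m : Z, zsum (fun q => f (q + m)%Z) n = zsum f n.
Proof.
intros P.
assert (S1 : forall m, zsum (fun q => f (q + (m + 1))%Z) n = zsum (fun q => f (q + m)%Z) n).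
{ intros m.
  rewrite (zsum_ext _ (fun q => f (q + 1 + m)%Z)) by (intros; f_equal; lia).
  pose proof (zsum_succ (fun r => f (r + m)%Z) n) as E; cbv beta in E; rewrite E.
  replace (Z.of_nat n + m)%Z with (0 + m + Z.of_nat n)%Z by lia.
  rewrite P; ring. }
intros m; induction m as [|m IH|m IH] using Z.peano_ind.
- apply zsum_ext; intros; f_equal; lia.
- unfold Z.succ; rewrite S1; exact IH.
- rewrite <- IH, <- (S1 (Z.pred m)).
  apply zsum_ext; intros; f_equal; lia.
Qed.

Lemma zsum_lim (f : nat -> Z -> R) (l : Z -> R) n :
  (forall q, is_lim_seq (fun k => f k q) (l q)) ->
  is_lim_seq (fun k => zsum (f k) n) (zsum l n).
Proof.
intros E; induction n as [|n IH]; simpl.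
- apply is_lim_seq_const.
- apply is_lim_seq_plus'; [exact IH | apply E].
Qed.

Lemma zsum_eq0 (f : Z -> R) n :
  (forall q, 0 <= f q) -> zsum f n <= 0 ->
  forall q, (0 <= q < Z.of_nat n)%Z -> f q = 0.
Proof.
intros P S q Hq. pose proof (zsum_term_le f n q P Hq). specialize (P q); lra.
Qed.

Lemma strict_mono_le (phi : nat -> nat) :
  (forall n, (phi n < phi (S n))%nat) -> forall n, (n <= phi n)%nat.
Proof. intros H n; induction n as [|n IH]; [lia|]. specialize (H n); lia. Qed.

Lemma strict_mono_comp (phi psi : nat -> nat) :
  (forall n, (phi n < phi (S n))%nat) -> (forall n, (psi n < psi (S n))%nat) ->
  forall n, (phi (psi n) < phi (psi (S n)))%nat.
Proof.
intros H K n.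
assert (M : forall p q, (p < q)%nat -> (phi p < phi q)%nat).
{ intros p q L; induction L as [|q L IH]; [apply H|]. specialize (H q); lia. }
apply M, K.
Qed.

Lemma bolzano_weierstrass_subseq (x : nat -> R) (lo hi : R) :
  (forall n, lo <= x n <= hi) ->
  exists (phi : nat -> nat) (l : R),
    (forall n, (phi n < phi (S n))%nat) /\ is_lim_seq (fun n => x (phi n)) l.
Proof.
intros Hx.
destruct (Bolzano_Weierstrass x (fun c => lo <= c <= hi) (compact_P3 lo hi) Hx) as [l Hl].
assert (E : forall N : nat, forall eps : posreal,
          exists p, (N <= p)%nat /\ Rabs (x p - l) < eps).
{ intros N eps. destruct (Hl (disc l eps) N) as [p [Hp D]].
  - exists eps; intros y Hy; exact Hy.
  - exists p; split; [exact Hp | exact D]. }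
assert (E' : forall N k : nat, exists p, (N <= p)%nat /\ Rabs (x p - l) < / INR (S k)).
{ intros N k.
  assert (P : 0 < / INR (S k)) by (apply Rinv_0_lt_compat, lt_0_INR; lia).
  exact (E N (mkposreal _ P)). }
pose (pick N k := proj1_sig (constructive_indefinite_description _ (E' N k))).
assert (Hpick : forall N k, (N <= pick N k)%nat /\ Rabs (x (pick N k) - l) < / INR (S k)).
{ intros N k; exact (proj2_sig (constructive_indefinite_description _ (E' N k))). }
(* Each index is taken beyond its predecessor, with value within 1 / (n + 1) of the adherent value
   [l]. *)
pose (phi := fix phi (n : nat) : nat :=
        match n with O => pick O O | S k => pick (S (phi k)) (S k) end).
exists phi, l; split.
- intros n; simpl. destruct (Hpick (S (phi n)) (S n)); lia.
- assert (B : forall n, Rabs (x (phi n) - l) < / INR (S n)).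
  { intros [|n]; [apply (Hpick O O) | apply (Hpick (S (phi n)) (S n))]. }
  assert (L0 : is_lim_seq (fun n => / INR (S n)) 0).
  { apply (is_lim_seq_incr_1 (fun n => / INR n)).
    replace (Finite 0) with (Rbar_inv p_infty) by reflexivity.
    apply is_lim_seq_inv; [apply is_lim_seq_INR | discriminate]. }
  apply (is_lim_seq_le_le (fun n => l - / INR (S n)) _ (fun n => l + / INR (S n))).
  + intros n. specialize (B n). apply Rabs_def2 in B. lra.
  + replace l with (l - 0) at 1 by ring.
    apply is_lim_seq_minus'; [apply is_lim_seq_const | exact L0].
  + replace l with (l + 0) at 1 by ring.
    apply is_lim_seq_plus'; [apply is_lim_seq_const | exact L0].
Qed.

(** Subsequences are extracted one coordinate after the other; passing to a further subsequence
    keeps the limits already found. *)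
Lemma bolzano_weierstrass_finite (X : nat -> Z -> R) (lo hi : R) (N : nat) :
  (forall n q, (0 <= q < Z.of_nat N)%Z -> lo <= X n q <= hi) ->
  exists phi : nat -> nat,
    (forall n, (phi n < phi (S n))%nat) /\
    (forall q, (0 <= q < Z.of_nat N)%Z ->
       exists l : R, is_lim_seq (fun n => X (phi n) q) l).
Proof.
induction N as [|N IH]; intros HX.
- exists (fun n => n); split; [intros; lia | intros q Hq; lia].
- destruct IH as [phi [Hphi Hl]]; [intros; apply HX; lia|].
  destruct (bolzano_weierstrass_subseq (fun n => X (phi n) (Z.of_nat N)) lo hi)
    as [psi [l [Hpsi Hlim]]]; [intros; apply HX; lia|].
  exists (fun n => phi (psi n)); split; [now apply strict_mono_comp|].
  intros q Hq. destruct (Z.eq_dec q (Z.of_nat N)) as [->|Nq]; [now exists l|].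
  destruct (Hl q) as [l' Hl']; [lia|]. exists l'.
  apply (is_lim_seq_subseq (fun n => X (phi n) q) _ psi); [|exact Hl'].
  now apply eventually_subseq.
Qed.

Lemma lipschitz_continuity (f : R -> R) (c : R) :
  (forall s t, Rabs (f s - f t) <= c * Rabs (s - t)) -> continuity f.
Proof.
intros Hf s eps Heps.
assert (Hc : 0 <= c).
{ pose proof (Hf 1 0) as E. pose proof (Rabs_pos (f 1 - f 0)).
  replace (1 - 0) with 1 in E by ring. rewrite Rabs_R1 in E. lra. }
(* The summand 1 covers the case [c = 0]. *)
exists (eps / (c + 1)); split; [apply Rdiv_lt_0_compat; lra|].
intros t [_ Ht]. simpl in *; unfold R_dist in *.
apply Rle_lt_trans with (1 := Hf t s).
apply Rle_lt_trans with ((c + 1) * Rabs (t - s)).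
- pose proof (Rabs_pos (t - s)); nra.
- apply Rlt_le_trans with ((c + 1) * (eps / (c + 1))).
  + apply Rmult_lt_compat_l; lra.
  + right; field; lra.
Qed.

(** * Monotone configurations *)

(* [u] lists the lifted angles of an orbit and of its translates in increasing order:
   if [u] has rotation type (m1, m2), the orbit itself is [fun i => u (i * m2)]. *)
Definition rot_class (m1 : nat) (u : Z -> R) : Prop :=
  (forall q, u (q + Z.of_nat m1)%Z = u q + 2 * PI) /\
  (forall q, u q <= u (q + 1)%Z).

Lemma rot_class_le m1 u : rot_class m1 u -> forall p q, (p <= q)%Z -> u p <= u q.
Proof.
intros [_ Hu] p q Hpq.
replace q with (p + Z.of_nat (Z.to_nat (q - p)))%Z by lia.
induction (Z.to_nat (q - p)) as [|n IH].
- rewrite Z.add_0_r; lra.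
- replace (p + Z.of_nat (S n))%Z with (p + Z.of_nat n + 1)%Z by lia.
  specialize (Hu (p + Z.of_nat n)%Z); lra.
Qed.

Lemma rot_class_period m1 u : rot_class m1 u ->
  forall k q, u (q + k * Z.of_nat m1)%Z = u q + 2 * PI * IZR k.
Proof.
intros [Hu _] k; induction k as [|k IH|k IH] using Z.peano_ind; intros q.
- replace (q + 0 * Z.of_nat m1)%Z with q by lia; simpl; ring.
- replace (q + Z.succ k * Z.of_nat m1)%Z with (q + k * Z.of_nat m1 + Z.of_nat m1)%Z by lia.
  rewrite Hu, IH, succ_IZR; ring.
- pose proof (Hu (q + Z.pred k * Z.of_nat m1)%Z) as E.
  replace (q + Z.pred k * Z.of_nat m1 + Z.of_nat m1)%Z with (q + k * Z.of_nat m1)%Z in E by lia.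
  rewrite IH in E. rewrite <- Z.sub_1_r, minus_IZR in *; lra.
Qed.

(** Write n = k m1 + r with 0 <= r < m1: the k periods contribute exactly 2 PI k, and monotonicity
    confines the remaining increment, like 2 PI r / m1, to [0, 2 PI]. The bound does not involve
    m1. *)
Lemma rot_class_rotation m1 u : (0 < m1)%nat -> rot_class m1 u ->
  forall q n, Rabs (u (q + n)%Z - u q - 2 * PI * IZR n / INR m1) <= 2 * PI.
Proof.
intros Hm Hu q n.
pose (M := Z.of_nat m1). assert (HM : (0 < M)%Z) by (unfold M; lia).
pose proof (Z.mod_pos_bound n M HM) as Hr.
pose proof (Z.div_mod n M ltac:(lia)) as Hd.
set (k := (n / M)%Z) in *. set (r := (n mod M)%Z) in *.
assert (Hm' : 0 < INR m1) by (apply lt_0_INR; lia).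
assert (E : u (q + n)%Z = u (q + r)%Z + 2 * PI * IZR k).
{ rewrite <- (rot_class_period m1 u Hu). f_equal. unfold M in *; lia. }
pose proof (rot_class_le m1 u Hu q (q + r)%Z ltac:(lia)) as L1.
pose proof (rot_class_le m1 u Hu (q + r)%Z (q + M)%Z ltac:(lia)) as L2.
destruct Hu as [Hp _]. unfold M in L2 at 1; rewrite Hp in L2.
assert (F : 2 * PI * IZR n / INR m1 = 2 * PI * IZR k + 2 * PI * (IZR r / INR m1)).
{ rewrite Hd, plus_IZR, mult_IZR. unfold M; rewrite <- INR_IZR_INZ. field; lra. }
assert (0 <= IZR r / INR m1 <= 1).
{ split.
  - apply Rmult_le_pos; [apply IZR_le; lia | left; now apply Rinv_0_lt_compat].
  - apply Rmult_le_reg_r with (INR m1); [lra|].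
    unfold Rdiv; rewrite Rmult_assoc, Rinv_l by lra.
    rewrite INR_IZR_INZ, Rmult_1_l, Rmult_1_r. apply IZR_le; unfold M in *; lia. }
pose proof PI_RGT_0. rewrite E, F. apply Rabs_le. nra.
Qed.

Lemma rot_class_shift m1 u k : rot_class m1 u -> rot_class m1 (fun q => u (q + k)%Z).
Proof.
intros [Hp Hi]; split; intros q.
- replace (q + Z.of_nat m1 + k)%Z with (q + k + Z.of_nat m1)%Z by lia. apply Hp.
- replace (q + 1 + k)%Z with (q + k + 1)%Z by lia. apply Hi.
Qed.

Lemma rot_class_lim m1 (U : nat -> Z -> R) (u : Z -> R) :
  (forall k, rot_class m1 (U k)) ->
  (forall q, is_lim_seq (fun k => U k q) (u q)) -> rot_class m1 u.
Proof.
intros HU Hl; split; intros q.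
- assert (E : is_lim_seq (fun k => U k (q + Z.of_nat m1)%Z) (u q + 2 * PI)).
  { apply (is_lim_seq_ext (fun k => U k q + 2 * PI)).
    - intros k; destruct (HU k) as [Hp _]; now rewrite Hp.
    - apply is_lim_seq_plus'; [apply Hl | apply is_lim_seq_const]. }
  apply is_lim_seq_unique in E. rewrite (is_lim_seq_unique _ _ (Hl _)) in E.
  now injection E.
- apply (is_lim_seq_le (fun k => U k q) (fun k => U k (q + 1)%Z) (u q) (u (q + 1)%Z));
    [|apply Hl|apply Hl].
  intros k; destruct (HU k) as [_ Hi]; apply Hi.
Qed.

(** A configuration is determined by its values at 0, ..., m1 - 1, and monotonicity keeps these
    within 2 PI of the value at 0, so the compactness is finite dimensional. *)
Lemma rot_class_compact m1 (U : nat -> Z -> R) lo hi : (0 < m1)%nat ->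
  (forall k, rot_class m1 (U k)) -> (forall k, lo <= U k 0%Z <= hi) ->
  exists (phi : nat -> nat) (u : Z -> R),
    (forall n, (phi n < phi (S n))%nat) /\
    (forall q, is_lim_seq (fun k => U (phi k) q) (u q)) /\ rot_class m1 u.
Proof.
intros Hm HU H0.
destruct (bolzano_weierstrass_finite U lo (hi + 2 * PI) m1) as [phi [Hphi Hl]].
{ intros k q Hq. specialize (H0 k).
  pose proof (rot_class_le _ _ (HU k) 0%Z q ltac:(lia)).
  pose proof (rot_class_le _ _ (HU k) q (0 + Z.of_nat m1)%Z ltac:(lia)) as P.
  destruct (HU k) as [Hp _]; rewrite Hp in P. lra. }
exists phi, (fun q => real (Lim_seq (fun k => U (phi k) q))).
assert (C : forall q, is_lim_seq (fun k => U (phi k) q) (real (Lim_seq (fun k => U (phi k) q)))).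
{ intros q.
  assert (E : exists l : R, is_lim_seq (fun k => U (phi k) q) l).
  { pose (M := Z.of_nat m1). assert (HM : (0 < M)%Z) by (unfold M; lia).
    pose proof (Z.mod_pos_bound q M HM) as Hr.
    pose proof (Z.div_mod q M ltac:(lia)) as Hd.
    destruct (Hl (q mod M)%Z Hr) as [l Hlq].
    exists (l + 2 * PI * IZR (q / M)).
    apply (is_lim_seq_ext (fun k => U (phi k) (q mod M)%Z + 2 * PI * IZR (q / M))).
    - intros k. rewrite <- (rot_class_period m1 _ (HU (phi k))).
      f_equal. unfold M in *; lia.
    - apply is_lim_seq_plus'; [exact Hlq | apply is_lim_seq_const]. }
  destruct E as [l E]. now rewrite (is_lim_seq_unique _ _ E). }
split; [exact Hphi|]. split; [exact C|].
apply (rot_class_lim m1 (fun k => U (phi k))); [intros; apply HU | exact C].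
Qed.

(** * Minimization by sequential compactness *)

Lemma is_lim_seq_dominated (f g : nat -> R) (l : R) :
  (forall n, Rabs (f n - l) <= g n) -> is_lim_seq g 0 -> is_lim_seq f l.
Proof.
intros Hf Hg.
apply (is_lim_seq_le_le (fun n => l - g n) _ (fun n => l + g n)).
- intros n; specialize (Hf n). apply Rabs_le_between in Hf; lra.
- replace l with (l - 0) at 1 by ring.
  apply is_lim_seq_minus'; [apply is_lim_seq_const | exact Hg].
- replace l with (l + 0) at 1 by ring.
  apply is_lim_seq_plus'; [apply is_lim_seq_const | exact Hg].
Qed.

Lemma is_lim_seq_Rabs_minus (f : nat -> R) (l : R) :
  is_lim_seq f l -> is_lim_seq (fun n => Rabs (f n - l)) 0.
Proof.
intros Hf. apply -> is_lim_seq_abs_0.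
replace 0 with (l - l) by ring.
apply is_lim_seq_minus'; [exact Hf | apply is_lim_seq_const].
Qed.

(** The infimum is taken in [Rbar], so no lower bound has to be known: along a convergent
    subsequence of a minimizing sequence it is identified with the finite value [W v]. *)
Lemma exists_min_of_seq_compact {T : Type} (P : T -> Prop) (W : T -> R) :
  (exists v, P v) ->
  (forall V : nat -> T, (forall n, P (V n)) ->
     exists (phi : nat -> nat) (v : T), (forall n, (phi n < phi (S n))%nat) /\ P v /\
       is_lim_seq (fun n => W (V (phi n))) (W v)) ->
  exists v, P v /\ forall w, P w -> W v <= W w.
Proof.
intros [v0 Pv0] Hc.
pose (E := fun y => exists v, P v /\ y = W v).
destruct (Glb_Rbar_correct E) as [Hlb Hglb].
assert (A : forall x : R, Rbar_lt (Glb_Rbar E) x -> exists v, P v /\ W v < x).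
{ intros x Hx. apply NNPP; intros N.
  apply (Rbar_lt_not_le _ _ Hx). apply Hglb. intros y [v [Pv ->]]; simpl.
  apply Rnot_lt_le; intros Hv; apply N; now exists v. }
assert (Q : exists V : nat -> T, (forall n, P (V n)) /\
              is_lim_seq (fun n => W (V n)) (Glb_Rbar E)).
{ destruct (Glb_Rbar E) as [g| |] eqn:Eg.
  - assert (S1 : forall n, exists v, P v /\ W v < g + / INR (S n)).
    { intros n; apply A; change (g < g + / INR (S n)).
      assert (0 < / INR (S n)) by (apply Rinv_0_lt_compat, lt_0_INR; lia). lra. }
    exists (fun n => proj1_sig (constructive_indefinite_description _ (S1 n))).
    split; [intros n; apply (proj2_sig (constructive_indefinite_description _ (S1 n)))|].
    apply (is_lim_seq_dominated _ (fun n => / INR (S n))).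
    + intros n. destruct (constructive_indefinite_description _ (S1 n)) as [v [Pv Hv]]; simpl.
      assert (G : Rbar_le g (W v)) by (apply Hlb; now exists v). simpl in G.
      rewrite Rabs_pos_eq by lra. change (match n with O => 1 | S _ => INR n + 1 end) with (INR (S n)). lra.
    + apply (is_lim_seq_incr_1 (fun n => / INR n)).
      replace (Finite 0) with (Rbar_inv p_infty) by reflexivity.
      apply is_lim_seq_inv; [apply is_lim_seq_INR | discriminate].
  - exfalso. assert (G : Rbar_le p_infty (W v0)) by (apply Hlb; now exists v0). exact G.
  - assert (S1 : forall n, exists v, P v /\ W v < - INR n) by (intros n; apply A; exact I).
    exists (fun n => proj1_sig (constructive_indefinite_description _ (S1 n))).
    split; [intros n; apply (proj2_sig (constructive_indefinite_description _ (S1 n)))|].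
    apply (is_lim_seq_le_m_loc (fun n => - INR n)).
    + exists O; intros n _.
      destruct (constructive_indefinite_description _ (S1 n)) as [v [Pv Hv]]; simpl; lra.
    + replace m_infty with (Rbar_opp p_infty) by reflexivity.
      apply -> is_lim_seq_opp; apply is_lim_seq_INR. }
destruct Q as [V [PV HV]].
destruct (Hc V PV) as [phi [v [Hphi [Pv Hv]]]].
exists v; split; [exact Pv|]. intros w Pw.
assert (U : is_lim_seq (fun n => W (V (phi n))) (Glb_Rbar E)).
{ apply (is_lim_seq_subseq (fun n => W (V n))); [now apply eventually_subseq | exact HV]. }
apply is_lim_seq_unique in U. rewrite (is_lim_seq_unique _ _ Hv) in U.
assert (G : Rbar_le (Glb_Rbar E) (W w)) by (apply Hlb; now exists w).
rewrite <- U in G; exact G.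
Qed.

(** * Critical points of the action *)

Section Chain.

Variables (H H1 H2 : R -> R -> R) (B L : R) (m1 : nat) (m2 : Z).
Hypothesis m1_pos : (0 < m1)%nat.
Hypothesis L_pos : 0 < L.
Hypothesis H_per : forall x y, H (x + 2 * PI) (y + 2 * PI) = H x y.
Hypothesis H1_per : forall x y, H1 (x + 2 * PI) (y + 2 * PI) = H1 x y.
Hypothesis H2_per : forall x y, H2 (x + 2 * PI) (y + 2 * PI) = H2 x y.
Hypothesis H_expand : forall x x' y y', Rabs (x' - x) <= B -> Rabs (y' - y) <= B ->
  Rabs (H y y' - H x x' - H1 x x' * (y - x) - H2 x x' * (y' - x'))
    <= L * ((y - x) ^ 2 + (y' - x') ^ 2).
Hypothesis H1_lip : forall x x' y y', Rabs (x' - x) <= B -> Rabs (y' - y) <= B ->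
  Rabs (H1 y y' - H1 x x') <= L * (Rabs (y - x) + Rabs (y' - x')).
Hypothesis H2_lip : forall x x' y y', Rabs (x' - x) <= B -> Rabs (y' - y) <= B ->
  Rabs (H2 y y' - H2 x x') <= L * (Rabs (y - x) + Rabs (y' - x')).
Hypothesis H1_anti : forall x x' y', x' <= y' -> H1 x y' <= H1 x x'.
Hypothesis H2_anti : forall x y x', x <= y -> H2 y x' <= H2 x x'.
Hypothesis B_large : Rabs (2 * PI * IZR m2 / INR m1) + 4 * PI <= B.

(** A step along minus the force changes the action by at most (- tau + 2 L tau^2) times the sum of
    squared forces; this choice makes the factor - tau / 2. Order preservation only asks for 2 L tau
    <= 1. *)
Let tau := / (4 * L).

(** The partial derivative of the action in the angle of index q, its periodic copies moving along.
    The neighbours in time of index q are q + m2 and q - m2, so the vanishing of this force is the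
    discrete Euler-Lagrange equation. *)
Definition chain_force (u : Z -> R) (q : Z) : R :=
  H1 (u q) (u (q + m2)%Z) + H2 (u (q - m2)%Z) (u q).
Definition chain_step (u : Z -> R) (q : Z) : R := u q - tau * chain_force u q.
Definition chain_action (u : Z -> R) : R := zsum (fun q => H (u q) (u (q + m2)%Z)) m1.

Notation cls := (rot_class m1).

Let tau_pos : 0 < tau.
Proof. apply Rinv_0_lt_compat; lra. Qed.

Let tau_L : tau * L = / 4.
Proof. unfold tau; field; lra. Qed.

(** Monotonicity costs 2 PI and replacing [u] by [v] at one end costs another 2 PI, whence the 4 PI
    in [B_large]. Such mixed bonds arise when two configurations are compared one variable at a
    time. *)
Lemma rot_class_bond u v : cls u -> cls v ->
  (forall q, u q - 2 * PI <= v q <= u q + 2 * PI) ->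
  forall q, Rabs (v (q + m2)%Z - u q) <= B.
Proof.
intros Hu Hv Huv q.
pose proof (rot_class_rotation m1 u m1_pos Hu q m2) as E.
specialize (Huv (q + m2)%Z).
apply Rabs_le_between in E.
pose proof (Rabs_le_between (2 * PI * IZR m2 / INR m1) (Rabs (2 * PI * IZR m2 / INR m1))) as [F _].
specialize (F (Rle_refl _)). apply Rabs_le; lra.
Qed.

Lemma rot_class_bond_self u : cls u -> forall q, Rabs (u (q + m2)%Z - u q) <= B.
Proof.
intros Hu. pose proof PI_RGT_0. apply rot_class_bond; try assumption. intros; lra.
Qed.

Lemma rot_class_bond_prev u : cls u -> forall q, Rabs (u q - u (q - m2)%Z) <= B.
Proof.
intros Hu q. pose proof (rot_class_bond_self u Hu (q - m2)%Z) as E.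
now rewrite Z.sub_add in E.
Qed.

Lemma chain_force_per u : cls u -> forall q, chain_force u (q + Z.of_nat m1)%Z = chain_force u q.
Proof.
intros [Hp _] q; unfold chain_force.
replace (q + Z.of_nat m1 + m2)%Z with (q + m2 + Z.of_nat m1)%Z by lia.
replace (q + Z.of_nat m1 - m2)%Z with (q - m2 + Z.of_nat m1)%Z by lia.
now rewrite !Hp, H1_per, H2_per.
Qed.

(** Raising the neighbours of an index can only lower its force, by [H1_anti] and [H2_anti]. Raising
    the angle itself raises the force by at most 2 L (v q - u q), and multiplication by tau turns
    this into half of v q - u q. The upper bound on [v] keeps the mixed bonds within B. *)
Lemma chain_step_le u v : cls u -> cls v ->
  (forall q, u q <= v q <= u q + 2 * PI) -> forall q, chain_step u q <= chain_step v q.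
Proof.
intros Hu Hv Huv q. unfold chain_step, chain_force.
assert (Huv' : forall p, u p - 2 * PI <= v p <= u p + 2 * PI).
{ intros p; specialize (Huv p); pose proof PI_RGT_0; lra. }
assert (Hvu' : forall p, v p - 2 * PI <= u p <= v p + 2 * PI).
{ intros p; specialize (Huv p); pose proof PI_RGT_0; lra. }
pose proof (rot_class_bond u v Hu Hv Huv' q) as A1.
pose proof (rot_class_bond_self v Hv q) as A2.
pose proof (rot_class_bond v u Hv Hu Hvu' (q - m2)%Z) as A3.
pose proof (rot_class_bond_prev v Hv q) as A4.
rewrite Z.sub_add in A3.
pose proof (H1_anti (u q) (u (q + m2)%Z) (v (q + m2)%Z) (proj1 (Huv _))) as M1.
pose proof (H2_anti (u (q - m2)%Z) (v (q - m2)%Z) (u q) (proj1 (Huv _))) as M2.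
pose proof (H1_lip (u q) (v (q + m2)%Z) (v q) (v (q + m2)%Z) A1 A2) as E1.
pose proof (H2_lip (v (q - m2)%Z) (u q) (v (q - m2)%Z) (v q) A3 A4) as E2.
rewrite !Rminus_diag, Rabs_R0 in *.
rewrite (Rabs_pos_eq (v q - u q)) in * by (specialize (Huv q); lra).
apply Rabs_le_between in E1. apply Rabs_le_between in E2.
assert (X : H1 (v q) (v (q + m2)%Z) + H2 (v (q - m2)%Z) (v q)
          - (H1 (u q) (u (q + m2)%Z) + H2 (u (q - m2)%Z) (u q)) <= 2 * L * (v q - u q)) by lra.
apply Rmult_le_compat_l with (r := tau) in X; [|lra].
specialize (Huv q). nra.
Qed.

Lemma chain_step_shift u q :
  chain_step (fun p => u (p + 1)%Z) q = chain_step u (q + 1)%Z.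
Proof.
unfold chain_step, chain_force.
replace (q + 1 + m2)%Z with (q + m2 + 1)%Z by lia.
now replace (q + 1 - m2)%Z with (q - m2 + 1)%Z by lia.
Qed.

(** Monotonicity says that [u] lies below its translate by one index. The step commutes with this
    translation and preserves the order. *)
Lemma chain_step_class u : cls u -> cls (chain_step u).
Proof.
intros Hu; split; intros q.
- unfold chain_step. rewrite (chain_force_per u Hu). destruct Hu as [Hp _]; rewrite Hp; ring.
- replace (chain_step u (q + 1)%Z) with (chain_step (fun p => u (p + 1)%Z) q).
  + apply chain_step_le; [assumption | now apply rot_class_shift |].
    intros p; split; [apply Hu|]. destruct Hu as [Hp Hi]. rewrite <- Hp.
    apply (rot_class_le m1 u (conj Hp Hi)); lia.
  + apply chain_step_shift.
Qed.

(** Each bond is expanded to second order at its two ends. Collected at a single index, the linear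
    terms give - tau times the squared force and the two remainders 2 L tau^2 times it. *)
Lemma chain_action_descent u : cls u ->
  chain_action (chain_step u)
    <= chain_action u - tau / 2 * zsum (fun q => chain_force u q ^ 2) m1.
Proof.
intros Hu. pose proof (chain_step_class u Hu) as Hs.
pose (v q := - tau * chain_force u q).
pose (a q := H1 (u q) (u (q + m2)%Z)). pose (b q := H2 (u q) (u (q + m2)%Z)).
assert (Hv : forall q, v (q + Z.of_nat m1)%Z = v q).
{ intros q; unfold v; now rewrite chain_force_per. }
assert (Hb : forall q, b (q + Z.of_nat m1)%Z = b q).
{ intros q; unfold b. replace (q + Z.of_nat m1 + m2)%Z with (q + m2 + Z.of_nat m1)%Z by lia.
  destruct Hu as [Hp _]; now rewrite !Hp, H2_per. }
assert (E : chain_action (chain_step u) <= zsum (fun q =>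
   (H (u q) (u (q + m2)%Z) + a q * v q + L * v q ^ 2)
   + (b q * v (q + m2)%Z + L * v (q + m2)%Z ^ 2)) m1).
{ apply zsum_le; intros q.
  pose proof (H_expand _ _ _ _ (rot_class_bond_self u Hu q) (rot_class_bond_self _ Hs q)) as X.
  apply Rabs_le_between in X. destruct X as [_ X].
  replace (chain_step u q - u q) with (v q) in X by (unfold v, chain_step; ring).
  replace (chain_step u (q + m2)%Z - u (q + m2)%Z) with (v (q + m2)%Z) in X
    by (unfold v, chain_step; ring).
  unfold a, b. lra. }
rewrite zsum_plus in E.
(* Re-indexing by m2 moves the terms at the right end of each bond to the index of that end. *)
pose proof (zsum_shift (fun q => b (q - m2)%Z * v q + L * v q ^ 2) m1) as Sh; cbv beta in Sh.
specialize (Sh ltac:(intros q; rewrite Hv;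
   replace (q + Z.of_nat m1 - m2)%Z with (q - m2 + Z.of_nat m1)%Z by lia; now rewrite Hb) m2).
rewrite (zsum_ext _ (fun q => b q * v (q + m2)%Z + L * v (q + m2)%Z ^ 2)) in Sh
  by (intros q; now replace (q + m2 - m2)%Z with q by lia).
rewrite Sh, <- zsum_plus in E.
apply Rle_trans with (1 := E). right.
unfold chain_action.
replace (zsum (fun q => H (u q) (u (q + m2)%Z)) m1 - tau / 2 * zsum (fun q => chain_force u q ^ 2) m1)
  with (zsum (fun q => H (u q) (u (q + m2)%Z)) m1 + (- (tau / 2)) * zsum (fun q => chain_force u q ^ 2) m1)
  by ring.
rewrite <- zsum_scal, <- zsum_plus. apply zsum_ext; intros q.
unfold a, b, v. rewrite Z.sub_add.
assert (G : H1 (u q) (u (q + m2)%Z) = chain_force u q - H2 (u (q - m2)%Z) (u q))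
  by (unfold chain_force; ring).
rewrite G.
replace (L * (- tau * chain_force u q) ^ 2) with (tau * L * (tau * chain_force u q ^ 2)) by ring.
rewrite tau_L. field.
Qed.

Lemma chain_force_0 u : cls u -> zsum (fun q => chain_force u q ^ 2) m1 <= 0 ->
  forall q, chain_force u q = 0.
Proof.
intros Hu Z0 q.
assert (Q : forall p, (0 <= p < Z.of_nat m1)%Z -> chain_force u p = 0).
{ intros p Hp.
  assert (chain_force u p ^ 2 = 0).
  { apply (zsum_eq0 (fun q => chain_force u q ^ 2) m1); [intros; apply pow2_ge_0 | exact Z0 | exact Hp]. }
  nra. }
pose proof (Z.div_mod q (Z.of_nat m1) ltac:(lia)) as Hd.
pose proof (Z.mod_pos_bound q (Z.of_nat m1) ltac:(lia)) as Hr.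
rewrite <- (Q _ Hr), <- (Zperiodic_mul _ _ (chain_force_per u Hu) (q / Z.of_nat m1)%Z (q mod Z.of_nat m1)%Z).
f_equal; lia.
Qed.

Lemma chain_step_fixed_iff u q : chain_step u q = u q <-> chain_force u q = 0.
Proof. unfold chain_step; split; intros E; [|rewrite E; ring].
apply (Rmult_eq_reg_l tau); lra.
Qed.

(** The only competitor is [chain_step u], which is again monotone. A minimizer under the
    monotonicity constraint is therefore critical without any analysis of the boundary of the
    class. *)
Lemma chain_action_min_fixed u : cls u ->
  chain_action u <= chain_action (chain_step u) -> forall q, chain_force u q = 0.
Proof.
intros Hu Hm. apply chain_force_0; [exact Hu|].
pose proof (chain_action_descent u Hu). nra.
Qed.

Lemma lipschitz_lim (f : R -> R -> R) (X Y : nat -> R) (x y : R) :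
  (forall x x' y y', Rabs (x' - x) <= B -> Rabs (y' - y) <= B ->
     Rabs (f y y' - f x x') <= L * (Rabs (y - x) + Rabs (y' - x'))) ->
  (forall n, Rabs (Y n - X n) <= B) -> Rabs (y - x) <= B ->
  is_lim_seq X x -> is_lim_seq Y y -> is_lim_seq (fun n => f (X n) (Y n)) (f x y).
Proof.
intros Hf HB Hb HX HY.
apply (is_lim_seq_dominated _ (fun n => L * (Rabs (X n - x) + Rabs (Y n - y)))).
- intros n; apply Hf; auto.
- replace (Finite 0) with (Rbar_mult L (Finite (0 + 0))) by (simpl; f_equal; ring).
  apply is_lim_seq_scal_l.
  apply is_lim_seq_plus'; now apply is_lim_seq_Rabs_minus.
Qed.

Lemma chain_force_lim (U : nat -> Z -> R) (u : Z -> R) :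
  (forall k, cls (U k)) -> (forall q, is_lim_seq (fun k => U k q) (u q)) ->
  forall q, is_lim_seq (fun k => chain_force (U k) q) (chain_force u q).
Proof.
intros HU Hl q. pose proof (rot_class_lim m1 U u HU Hl) as Hu.
apply is_lim_seq_plus'; apply lipschitz_lim; auto;
  intros; try apply rot_class_bond_self; try apply rot_class_bond_prev; auto.
Qed.

Lemma chain_step_lim (U : nat -> Z -> R) (u : Z -> R) :
  (forall k, cls (U k)) -> (forall q, is_lim_seq (fun k => U k q) (u q)) ->
  forall q, is_lim_seq (fun k => chain_step (U k) q) (chain_step u q).
Proof.
intros HU Hl q. unfold chain_step.
apply is_lim_seq_minus'; [apply Hl|].
apply (is_lim_seq_scal_l _ tau (Finite (chain_force u q))).
now apply chain_force_lim.
Qed.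

(** Continuity of H along bonds of length at most B is read off from the expansion [H_expand]. *)
Lemma chain_action_lim (U : nat -> Z -> R) (u : Z -> R) :
  (forall k, cls (U k)) -> (forall q, is_lim_seq (fun k => U k q) (u q)) ->
  is_lim_seq (fun k => chain_action (U k)) (chain_action u).
Proof.
intros HU Hl. pose proof (rot_class_lim m1 U u HU Hl) as Hu.
apply (zsum_lim (fun k q => H (U k q) (U k (q + m2)%Z))
         (fun q => H (u q) (u (q + m2)%Z))).
intros q.
pose (x := u q). pose (x' := u (q + m2)%Z).
apply (is_lim_seq_dominated _ (fun k =>
   Rabs (H1 x x') * Rabs (U k q - x) + Rabs (H2 x x') * Rabs (U k (q + m2)%Z - x')
   + L * (Rabs (U k q - x) * Rabs (U k q - x)
          + Rabs (U k (q + m2)%Z - x') * Rabs (U k (q + m2)%Z - x')))).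
- intros k.
  pose proof (H_expand _ _ _ _ (rot_class_bond_self u Hu q) (rot_class_bond_self _ (HU k) q)) as X.
  fold x x' in X |- *.
  rewrite <- !Rabs_mult, (Rabs_pos_eq ((U k q - x) * (U k q - x))) by (apply Rle_0_sqr).
  rewrite (Rabs_pos_eq ((U k (q + m2)%Z - x') * (U k (q + m2)%Z - x'))) by (apply Rle_0_sqr).
  replace (H (U k q) (U k (q + m2)%Z) - H x x') with
    ((H1 x x' * (U k q - x)) + (H2 x x' * (U k (q + m2)%Z - x')) +
     (H (U k q) (U k (q + m2)%Z) - H x x' - H1 x x' * (U k q - x) - H2 x x' * (U k (q + m2)%Z - x')))
    by ring.
  eapply Rle_trans; [apply Rabs_triang|].
  apply Rplus_le_compat; [apply Rabs_triang|]. lra.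
- pose proof (is_lim_seq_Rabs_minus _ _ (Hl q)) as A1. fold x in A1.
  pose proof (is_lim_seq_Rabs_minus _ _ (Hl (q + m2)%Z)) as A2. fold x' in A2.
  replace 0 with (Rabs (H1 x x') * 0 + Rabs (H2 x x') * 0 + L * (0 * 0 + 0 * 0)) by ring.
  apply is_lim_seq_plus'; [apply is_lim_seq_plus'|].
  + exact (is_lim_seq_scal_l _ (Rabs (H1 x x')) 0 A1).
  + exact (is_lim_seq_scal_l _ (Rabs (H2 x x')) 0 A2).
  + apply (is_lim_seq_scal_l _ L (Finite (0 * 0 + 0 * 0))).
    apply is_lim_seq_plus'; now apply is_lim_seq_mult'.
Qed.

(** Stated for any closed set of configurations with bounded value at 0: it serves for the global
    minimizer and again for the section of the minimax. *)
Lemma exists_chain_action_min (P : (Z -> R) -> Prop) lo hi :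
  (exists v, P v) ->
  (forall v, P v -> cls v /\ lo <= v 0%Z <= hi) ->
  (forall (U : nat -> Z -> R) (u : Z -> R), (forall k, P (U k)) ->
     (forall q, is_lim_seq (fun k => U k q) (u q)) -> P u) ->
  exists v, P v /\ forall w, P w -> chain_action v <= chain_action w.
Proof.
intros He Hc Hcl. apply exists_min_of_seq_compact; [exact He|].
intros V HV.
destruct (rot_class_compact m1 V lo hi m1_pos) as [phi [u [Hphi [Hl Hu]]]];
  [intros; now apply Hc | intros; now apply Hc|].
exists phi, u; split; [exact Hphi|]; split.
- apply (Hcl (fun k => V (phi k))); auto.
- apply (chain_action_lim (fun k => V (phi k))); [intros; now apply Hc | exact Hl].
Qed.


Lemma chain_action_shift u : cls u ->
  forall k, chain_action (fun q => u (q + k)%Z) = chain_action u.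
Proof.
intros Hu k. unfold chain_action.
rewrite <- (zsum_shift (fun q => H (u q) (u (q + m2)%Z)) m1) with (m := k).
- apply zsum_ext; intros q. now replace (q + m2 + k)%Z with (q + k + m2)%Z by lia.
- intros q. replace (q + Z.of_nat m1 + m2)%Z with (q + m2 + Z.of_nat m1)%Z by lia.
  destruct Hu as [Hp _]; now rewrite !Hp, H_per.
Qed.

Lemma rot_class_linear : cls (fun q => 2 * PI * IZR q / INR m1).
Proof.
assert (Hm' : 0 < INR m1) by (apply lt_0_INR; lia). pose proof PI_RGT_0.
split; intros q; rewrite plus_IZR.
- rewrite <- INR_IZR_INZ; field; lra.
- apply Rmult_le_compat_r; [left; now apply Rinv_0_lt_compat | nra].
Qed.

(** The class is invariant under addition of 2 PI, hence not compact; compactness is recovered by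
    placing the value at 0 in [0, 2 PI], and a translation by a multiple of m1 brings any competitor
    there without changing its action. *)
Lemma exists_chain_minimizer : exists u, cls u /\ forall w, cls w -> chain_action u <= chain_action w.
Proof.
destruct (exists_chain_action_min (fun u => cls u /\ 0 <= u 0%Z <= 2 * PI) 0 (2 * PI))
  as [u [[Hu _] Hmin]].
- eexists; split; [apply rot_class_linear|]. simpl. pose proof PI_RGT_0. lra.
- auto.
- intros U u HU Hl; split.
  + apply (rot_class_lim m1 U); [intros; apply HU | exact Hl].
  + split.
    * apply (is_lim_seq_le (fun _ => 0) (fun k => U k 0%Z) 0 (u 0%Z));
        [intros; apply HU | apply is_lim_seq_const | apply Hl].
    * apply (is_lim_seq_le (fun k => U k 0%Z) (fun _ => 2 * PI) (u 0%Z) (2 * PI));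
        [intros; apply HU | apply Hl | apply is_lim_seq_const].
- exists u; split; [exact Hu|]. intros w Hw.
  pose proof PI_RGT_0 as HPI.
  (* With this k the translated value w 0 + 2 PI k lies in (0, 2 PI]. *)
  destruct (archimed (- w 0%Z / (2 * PI))) as [A1 A2].
  set (k := up (- w 0%Z / (2 * PI))) in *.
  rewrite <- (chain_action_shift w Hw (k * Z.of_nat m1)).
  apply Hmin; split; [now apply rot_class_shift|].
  rewrite (rot_class_period m1 w Hw).
  assert (E : w 0%Z = - (2 * PI) * (- w 0%Z / (2 * PI))) by (field; lra).
  set (t := - w 0%Z / (2 * PI)) in *. nra.
Qed.

(** The force varies by at most 4 L D, and tau L = 1/4 turns this into a second D. Iterating, the
    k-th image of a path is Lipschitz with constant growing like 2^k, which suffices for continuity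
    at each fixed k. *)
Lemma chain_step_lipschitz u v D : cls u -> cls v ->
  (forall q, Rabs (u q - v q) <= D) ->
  forall q, Rabs (chain_step u q - chain_step v q) <= 2 * D.
Proof.
intros Hu Hv HD q. unfold chain_step, chain_force.
pose proof (H1_lip _ _ _ _ (rot_class_bond_self v Hv q) (rot_class_bond_self u Hu q)) as E1.
pose proof (H2_lip _ _ _ _ (rot_class_bond_prev v Hv q) (rot_class_bond_prev u Hu q)) as E2.
pose proof (HD q) as D1. pose proof (HD (q + m2)%Z) as D2. pose proof (HD (q - m2)%Z) as D3.
set (a := H1 (u q) (u (q + m2)%Z)) in *. set (a' := H1 (v q) (v (q + m2)%Z)) in *.
set (b := H2 (u (q - m2)%Z) (u q)) in *. set (b' := H2 (v (q - m2)%Z) (v q)) in *.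
replace (u q - tau * (a + b) - (v q - tau * (a' + b')))
  with ((u q - v q) + - tau * ((a - a') + (b - b'))) by ring.
eapply Rle_trans; [apply Rabs_triang|].
rewrite Rabs_mult, Rabs_Ropp, (Rabs_pos_eq tau) by lra.
assert (X : Rabs (a - a' + (b - b')) <= 4 * (L * D)).
{ eapply Rle_trans; [apply Rabs_triang|]. nra. }
apply (Rmult_le_compat_l tau) in X; [|lra].
replace (tau * (4 * (L * D))) with (4 * (tau * L) * D) in X by ring.
rewrite tau_L in X. lra.
Qed.

(* Minimax between a minimizer [u] and its neighbour [u (q + 1)]: every path joining them
   crosses the section [gap = PI], where the action is at least [c > chain_action u]
   (or a further minimizer lies there). Moving a path by the monotone descent keeps it between
   the two, so some point of the initial path keeps action at least [c] forever and its
   descent accumulates at a third critical configuration. *)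
Lemma exists_chain_critical_pair :
  exists u z, cls u /\ cls z /\
    (forall q, chain_force u q = 0) /\ (forall q, chain_force z q = 0) /\
    (forall q, u q <= z q <= u (q + 1)%Z) /\
    (exists q, z q <> u q) /\ (exists q, z q <> u (q + 1)%Z).
Proof.
destruct exists_chain_minimizer as [u [Hu Hmin]].
pose proof PI_RGT_0 as HPI.
pose (y q := u (q + 1)%Z).
assert (Hy : cls y) by now apply rot_class_shift.
assert (Fu : chain_step u = u).
{ apply functional_extensionality; intros q. apply chain_step_fixed_iff.
  apply chain_action_min_fixed; [exact Hu|]. now apply Hmin, chain_step_class. }
assert (Fy : chain_step y = y).
{ apply functional_extensionality; intros q. unfold y.
  now rewrite chain_step_shift, Fu. }
assert (Wy : chain_action y = chain_action u) by now apply chain_action_shift.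
assert (Huy : forall q, u q <= y q <= u q + 2 * PI).
{ intros q; split; [apply Hu|]. destruct Hu as [Hp Hi]. rewrite <- Hp.
  apply (rot_class_le m1 u (conj Hp Hi)); lia. }
(* The order interval between two fixed points of an order preserving step is invariant. *)
pose (box z := cls z /\ forall q, u q <= z q <= y q).
assert (Bstep : forall z, box z -> box (chain_step z)).
{ intros z [Hz Hb]; split; [now apply chain_step_class|].
  intros q. replace (u q) with (chain_step u q) by now rewrite Fu.
  replace (y q) with (chain_step y q) by now rewrite Fy.
  split; apply chain_step_le; auto;
  intros p; specialize (Hb p); specialize (Huy p); lra. }
assert (Blim : forall (U : nat -> Z -> R) (z : Z -> R), (forall k, box (U k)) ->
   (forall q, is_lim_seq (fun k => U k q) (z q)) -> box z).
{ intros U z HU Hl; split.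
  - apply (rot_class_lim m1 U); [intros; apply HU | exact Hl].
  - intros q; split.
    + apply (is_lim_seq_le (fun _ => u q) (fun k => U k q) (u q) (z q));
        [intros; apply HU | apply is_lim_seq_const | apply Hl].
    + apply (is_lim_seq_le (fun k => U k q) (fun _ => y q) (z q) (y q));
        [intros; apply HU | apply Hl | apply is_lim_seq_const]. }
(* A continuous function separating the endpoints: it vanishes at [u], and telescopes over one
   period to 2 PI at [y]. *)
pose (gap z := zsum (fun q => z q - u q) m1).
assert (Sy : gap y = 2 * PI).
{ unfold gap, y. rewrite (zsum_ext _ (fun q => u (q + 1)%Z + -1 * u q)) by (intros; ring).
  rewrite zsum_plus, zsum_succ, zsum_scal. destruct Hu as [Hp _].
  replace (Z.of_nat m1) with (0 + Z.of_nat m1)%Z by lia. rewrite Hp; ring. }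
assert (Su : gap u = 0).
{ unfold gap. rewrite (zsum_ext _ (fun q => 0 * u q)) by (intros; ring).
  rewrite zsum_scal; ring. }
(* The parameter is clamped to [0, 1] because [IVT_cor] asks for continuity on the whole line. *)
pose (gam s := fun q => u q + Rmax 0 (Rmin 1 s) * (y q - u q)).
assert (Hc : forall s, 0 <= Rmax 0 (Rmin 1 s) <= 1).
{ intros s. split; [apply Rmax_l|]. apply Rmax_lub; [lra | apply Rmin_l]. }
assert (Bgam : forall s, box (gam s)).
{ intros s. specialize (Hc s). unfold gam. set (c := Rmax 0 (Rmin 1 s)) in *. split; [split|]; intros q.
  - destruct Hu as [Hp _], Hy as [Hp' _]. rewrite Hp, Hp'; ring.
  - destruct Hu as [_ Hi], Hy as [_ Hi']. specialize (Hi q); specialize (Hi' q). nra.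
  - specialize (Huy q). nra. }
assert (Lgam : forall s t q, Rabs (gam s q - gam t q) <= 2 * PI * Rabs (s - t)).
{ intros s t q. unfold gam.
  replace (u q + Rmax 0 (Rmin 1 s) * (y q - u q) - (u q + Rmax 0 (Rmin 1 t) * (y q - u q)))
    with ((y q - u q) * (Rmax 0 (Rmin 1 s) - Rmax 0 (Rmin 1 t))) by ring.
  rewrite Rabs_mult. apply Rmult_le_compat; try apply Rabs_pos.
  - specialize (Huy q). rewrite Rabs_pos_eq; lra.
  - unfold Rmax, Rmin. repeat destruct Rle_dec; unfold Rabs; repeat destruct Rcase_abs; lra. }
pose (it k s := Nat.iter k chain_step (gam s)).
assert (Bit : forall k s, box (it k s)).
{ intros k s; induction k as [|k IH]; [apply Bgam | now apply Bstep]. }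
assert (Lit : forall k s t q, Rabs (it k s q - it k t q) <= 2 ^ k * (2 * PI * Rabs (s - t))).
{ intros k s t; induction k as [|k IH]; intros q.
  - rewrite pow_O, Rmult_1_l; apply Lgam.
  - simpl pow. rewrite Rmult_assoc. apply chain_step_lipschitz; [apply Bit | apply Bit | exact IH]. }
assert (Wit : forall k l s, (k <= l)%nat -> chain_action (it l s) <= chain_action (it k s)).
{ intros k l s Hkl; induction Hkl as [|l Hkl IH]; [lra|].
  pose proof (chain_action_descent (it l s) (proj1 (Bit l s))) as D.
  assert (0 <= zsum (fun q => chain_force (it l s) q ^ 2) m1)
    by (apply zsum_ge0; intros; apply pow2_ge_0).
  change (it (S l) s) with (chain_step (it l s)). nra. }
destruct (exists_chain_action_min (fun z => box z /\ gap z = PI) (u 0%Z) (y 0%Z))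
  as [zs [[Bzs Szs] Hzs]].
{ exists (gam (/ 2)); split; [apply Bgam|].
  unfold gap, gam. replace (Rmax 0 (Rmin 1 (/ 2))) with (/ 2).
  - rewrite (zsum_ext _ (fun q => / 2 * (y q - u q))) by (intros; ring).
    rewrite zsum_scal. fold (gap y). rewrite Sy; field.
  - unfold Rmax, Rmin; repeat destruct Rle_dec; lra. }
{ intros v [[Hv Hb] _]; split; [exact Hv | apply Hb]. }
{ intros U z HU Hl; split; [apply (Blim U); [apply HU | exact Hl]|].
  assert (E : is_lim_seq (fun k => gap (U k)) (gap z)).
  { apply (zsum_lim (fun k q => U k q - u q) (fun q => z q - u q)). intros q.
    apply is_lim_seq_minus'; [apply Hl | apply is_lim_seq_const]. }
  apply (is_lim_seq_ext _ (fun _ => PI)) in E; [|intros k; apply HU].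
  apply is_lim_seq_unique in E. rewrite Lim_seq_const in E. now injection E. }
assert (Fin : forall z, box z -> (forall q, chain_force z q = 0) ->
   (exists q, z q <> u q) -> (exists q, z q <> u (q + 1)%Z) ->
   exists u z, cls u /\ cls z /\
    (forall q, chain_force u q = 0) /\ (forall q, chain_force z q = 0) /\
    (forall q, u q <= z q <= u (q + 1)%Z) /\
    (exists q, z q <> u q) /\ (exists q, z q <> u (q + 1)%Z)).
{ intros z [Hz Hb] Hf N1 N2. exists u, z. repeat (split; [now auto|]).
  split; [|now auto]. intros q; apply chain_step_fixed_iff; now rewrite Fu. }
assert (Ne : forall z w, z <> w -> exists q : Z, z q <> w q :> R).
{ intros z w N. apply NNPP; intros C. apply N, functional_extensionality; intros q.
  apply NNPP; intros E; apply C; now exists q. }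
destruct (Rle_lt_dec (chain_action zs) (chain_action u)) as [Hle|Hlt].
- apply (Fin zs Bzs).
  + apply chain_action_min_fixed; [apply Bzs|].
    apply Rle_trans with (1 := Hle). apply Hmin, chain_step_class, Bzs.
  + apply Ne; intros E; rewrite E in Szs; lra.
  + apply (Ne zs y); intros E; rewrite E in Szs; lra.
(* The endpoints are fixed by the step, so the n-th image of the path still joins them and meets the
   section. *)
- assert (Cross : forall n, exists s, 0 <= s <= 1 /\ gap (it n s) = PI).
  { intros n.
    assert (I0 : gap (it n 0) = 0).
    { transitivity (gap u); [|exact Su]. f_equal. unfold it. replace (gam 0) with u.
      - clear - Fu Fy. induction n as [|n IH]; [reflexivity|]. rewrite Nat.iter_succ, IH; exact Fu.
      - apply functional_extensionality; intros q; unfold gam.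
        replace (Rmax 0 (Rmin 1 0)) with 0; [ring|].
        unfold Rmax, Rmin; repeat destruct Rle_dec; lra. }
    assert (I1 : gap (it n 1) = 2 * PI).
    { transitivity (gap y); [|exact Sy]. f_equal. unfold it. replace (gam 1) with y.
      - clear - Fu Fy. induction n as [|n IH]; [reflexivity|]. rewrite Nat.iter_succ, IH; exact Fy.
      - apply functional_extensionality; intros q; unfold gam.
        replace (Rmax 0 (Rmin 1 1)) with 1; [ring|].
        unfold Rmax, Rmin; repeat destruct Rle_dec; lra. }
    destruct (IVT_cor (fun s => gap (it n s) - PI) 0 1) as [s [Hs Es]].
    - apply (lipschitz_continuity _ (INR m1 * (2 ^ n * (2 * PI)))). intros s t.
      replace (gap (it n s) - PI - (gap (it n t) - PI)) with
        (zsum (fun q => it n s q - it n t q) m1).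
      + rewrite !Rmult_assoc. apply zsum_Rabs_le; intros q.
        rewrite <- (Rmult_assoc 2 PI). apply Lit.
      + rewrite (zsum_ext _ (fun q => (it n s q - u q) + -1 * (it n t q - u q))) by (intros; ring).
        rewrite zsum_plus, zsum_scal. unfold gap; ring.
    - lra.
    - rewrite I0, I1. nra.
    - exists s; split; [exact Hs | lra]. }
  pose (sn n := proj1_sig (constructive_indefinite_description _ (Cross n))).
  assert (Hsn : forall n, 0 <= sn n <= 1 /\ gap (it n (sn n)) = PI)
    by (intros n; exact (proj2_sig (constructive_indefinite_description _ (Cross n)))).
  destruct (bolzano_weierstrass_subseq sn 0 1) as [phi [s [Hphi Hs]]]; [intros; apply Hsn|].
  (* For k <= n the point of parameter [sn n] has at time k at least its action at time n, where it
     lies on the section. With k fixed this passes to the limit parameter [s]. *)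
  assert (High : forall k, chain_action zs <= chain_action (it k s)).
  { intros k.
    assert (E : is_lim_seq (fun n => chain_action (it k (sn (phi n)))) (chain_action (it k s))).
    { apply chain_action_lim; [intros; apply Bit|]. intros q.
      apply (is_lim_seq_dominated _ (fun n => (2 ^ k * (2 * PI)) * Rabs (sn (phi n) - s))).
      - intros n. rewrite Rmult_assoc. apply Lit.
      - replace (Finite 0) with (Rbar_mult (2 ^ k * (2 * PI)) 0) by (simpl; f_equal; ring).
        apply is_lim_seq_scal_l. now apply is_lim_seq_Rabs_minus. }
    apply (is_lim_seq_le_loc (fun _ => chain_action zs)
             (fun n => chain_action (it k (sn (phi n)))) (chain_action zs) (chain_action (it k s)));
      [|apply is_lim_seq_const | exact E].
    exists k; intros n Hn.
    apply Rle_trans with (chain_action (it (phi n) (sn (phi n)))).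
    - apply Hzs; split; [apply Bit | apply Hsn].
    - apply Wit. pose proof (strict_mono_le phi Hphi n); lia. }
  destruct (rot_class_compact m1 (fun k => it k s) (u 0%Z) (y 0%Z) m1_pos)
    as [psi [z [Hpsi [Hl Hz]]]]; [intros; apply Bit | intros; apply Bit|].
  assert (Lz : is_lim_seq (fun k => chain_action (it (psi k) s)) (chain_action z))
    by (apply chain_action_lim; [intros; apply Bit | exact Hl]).
  assert (Wz : chain_action zs <= chain_action z).
  { apply (is_lim_seq_le (fun _ => chain_action zs) (fun k => chain_action (it (psi k) s))
      (chain_action zs) (chain_action z)); [intros; apply High | apply is_lim_seq_const | exact Lz]. }
  assert (Bz : box z) by (apply (Blim (fun k => it (psi k) s)); [intros; apply Bit | exact Hl]).
  apply (Fin z Bz).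
  (* Since psi (k + 1) >= psi k + 1, one step from time psi k still leaves at least the action at
     time psi (k + 1). In the limit a step does not lower the action of [z]. *)
  + apply chain_action_min_fixed; [exact Hz|].
    apply (is_lim_seq_le (fun k => chain_action (it (psi (S k)) s))
             (fun k => chain_action (chain_step (it (psi k) s)))
             (chain_action z) (chain_action (chain_step z))).
    * intros k. change (chain_step (it (psi k) s)) with (it (S (psi k)) s).
      apply Wit. specialize (Hpsi k); lia.
    * now apply is_lim_seq_incr_1 in Lz.
    * apply chain_action_lim; [intros; apply chain_step_class, Bit|].
      apply chain_step_lim; [intros; apply Bit | exact Hl].
  (* The action of [z] is at least that of [zs], strictly above the common action of [u] and [y]. *)
  + apply Ne; intros E; rewrite E in Wz; lra.
  + apply (Ne z y); intros E; rewrite E in Wz; lra.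
Qed.

End Chain.

(** * Generating function of a twist map *)

Lemma is_derive_increment_between (f df : R -> R) (a b l u : R) : a <= b ->
  (forall s, a <= s <= b -> is_derive f s (df s)) ->
  (forall s, a <= s <= b -> l <= df s <= u) ->
  l * (b - a) <= f b - f a <= u * (b - a).
Proof.
intros Hab Hd Hb.
destruct (MVT_gen f a b df) as [s [Hs E]].
- rewrite Rmin_left, Rmax_right by lra. intros; apply Hd; lra.
- rewrite Rmin_left, Rmax_right by lra. intros t Ht. apply derivable_continuous_pt.
  exists (df t). apply is_derive_Reals, Hd, Ht.
- rewrite Rmin_left, Rmax_right in Hs by lra. specialize (Hb s Hs). rewrite E. nra.
Qed.

Lemma is_derive_increment_Rabs (f df : R -> R) (a b k : R) :
  (forall s, Rmin a b <= s <= Rmax a b -> is_derive f s (df s)) ->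
  (forall s, Rmin a b <= s <= Rmax a b -> Rabs (df s) <= k) ->
  Rabs (f b - f a) <= k * Rabs (b - a).
Proof.
intros Hd Hb.
destruct (MVT_gen f a b df) as [s [Hs E]].
- intros; apply Hd; lra.
- intros t Ht. apply derivable_continuous_pt.
  exists (df t). apply is_derive_Reals, Hd, Ht.
- rewrite E, Rabs_mult. apply Rmult_le_compat_r; [apply Rabs_pos | now apply Hb].
Qed.

Lemma Rabs_between_le a b s : Rmin a b <= s <= Rmax a b -> Rabs (s - a) <= Rabs (b - a).
Proof. unfold Rmin, Rmax, Rabs; repeat destruct Rle_dec; repeat destruct Rcase_abs; lra. Qed.

(** Indexed like the configuration, in the order of the angles: one iterate of the map is the
    translation of the index by m. *)
Definition map_orbit (F G : R -> R -> R) (lo hi : R) (m : Z) (u p : Z -> R) : Prop :=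
  forall q, lo < p q < hi /\ u (q + m)%Z = F (u q) (p q) /\ p (q + m)%Z = G (u q) (p q).

Section GeneratingFunction.

Variables (F G V Fx Fr Gx Gr : R -> R -> R) (lo hi c C eta : R).
Hypothesis lo_hi : lo < hi.
Hypothesis F_dx : forall x r : R, lo <= r <= hi -> is_derive (fun t => F t r) x (Fx x r).
Hypothesis F_dr : forall x r : R, lo <= r <= hi -> is_derive (fun s => F x s) r (Fr x r).
Hypothesis G_dx : forall x r : R, lo <= r <= hi -> is_derive (fun t => G t r) x (Gx x r).
Hypothesis G_dr : forall x r : R, lo <= r <= hi -> is_derive (fun s => G x s) r (Gr x r).
Hypothesis V_dx : forall x r : R, lo <= r <= hi ->
  is_derive (fun t => V t r) x (G x r * Fx x r - r).
Hypothesis V_dr : forall x r : R, lo <= r <= hi ->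
  is_derive (fun s => V x s) r (G x r * Fr x r).
Hypothesis Fx_near : forall x r : R, lo <= r <= hi -> Rabs (Fx x r - 1) <= eta.
Hypothesis Gx_near : forall x r : R, lo <= r <= hi -> Rabs (Gx x r) <= eta.
Hypothesis Gr_near : forall x r : R, lo <= r <= hi -> Rabs (Gr x r - 1) <= eta.
Hypothesis Fr_bounds : forall x r : R, lo <= r <= hi -> c <= Fr x r <= C.
Hypothesis c_pos : 0 < c.
Hypothesis eta_small : eta <= / 4.
Hypothesis eta_C : eta * (1 + 2 * C) <= 1.
Hypothesis Fx_lip : forall x y r, lo <= r <= hi -> Rabs (Fx y r - Fx x r) <= Rabs (y - x).
Hypothesis Gx_lip : forall x y r, lo <= r <= hi -> Rabs (Gx y r - Gx x r) <= Rabs (y - x).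
Hypothesis F_per : forall x r : R, lo <= r <= hi -> F (x + 2 * PI) r = F x r + 2 * PI.
Hypothesis G_per : forall x r : R, lo <= r <= hi -> G (x + 2 * PI) r = G x r.
Hypothesis V_per : forall x r : R, lo <= r <= hi -> V (x + 2 * PI) r = V x r.

Let eta_pos : 0 <= eta.
Proof. apply Rle_trans with (2 := Gx_near 0 lo ltac:(lra)); apply Rabs_pos. Qed.

Let C_pos : 0 < C.
Proof. pose proof (Fr_bounds 0 lo ltac:(lra)); lra. Qed.

Lemma F_incr_x x y r : lo <= r <= hi -> x <= y ->
  / 2 * (y - x) <= F y r - F x r <= 2 * (y - x).
Proof.
intros Hr Hxy.
apply (is_derive_increment_between (fun t => F t r) (fun t => Fx t r)); auto.
intros s _. pose proof (Fx_near s r Hr) as E. apply Rabs_le_between in E; lra.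
Qed.

Lemma F_incr_r x r s : lo <= r -> r <= s -> s <= hi ->
  c * (s - r) <= F x s - F x r <= C * (s - r).
Proof.
intros Hr Hrs Hs.
apply (is_derive_increment_between (fun t => F x t) (fun t => Fr x t)); auto.
- intros; apply F_dr; lra.
- intros; apply Fr_bounds; lra.
Qed.

Lemma G_lip_x x y r : lo <= r <= hi -> Rabs (G y r - G x r) <= eta * Rabs (y - x).
Proof.
intros Hr.
apply (is_derive_increment_Rabs (fun t => G t r) (fun t => Gx t r)); auto.
Qed.

Lemma G_incr_r x r s : lo <= r -> r <= s -> s <= hi ->
  (1 - eta) * (s - r) <= G x s - G x r <= (1 + eta) * (s - r).
Proof.
intros Hr Hrs Hs.
apply (is_derive_increment_between (fun t => G x t) (fun t => Gr x t)); auto.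
- intros; apply G_dr; lra.
- intros t Ht. pose proof (Gr_near x t ltac:(lra)) as E. apply Rabs_le_between in E; lra.
Qed.

Lemma F_lip_x x y r : lo <= r <= hi -> Rabs (F y r - F x r) <= 2 * Rabs (y - x).
Proof.
intros Hr. destruct (Rle_lt_dec x y) as [L|L].
- pose proof (F_incr_x x y r Hr L). rewrite !Rabs_pos_eq; lra.
- pose proof (F_incr_x y x r Hr ltac:(lra)). rewrite !Rabs_left1; lra.
Qed.

Lemma F_lip_r x r s : lo <= r <= hi -> lo <= s <= hi ->
  Rabs (F x s - F x r) <= C * Rabs (s - r).
Proof.
intros Hr Hs. destruct (Rle_lt_dec r s) as [L|L].
- pose proof (F_incr_r x r s ltac:(lra) L ltac:(lra)). rewrite !Rabs_pos_eq; try nra.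
- pose proof (F_incr_r x s r ltac:(lra) ltac:(lra) ltac:(lra)). rewrite !Rabs_left1; try nra.
Qed.

Lemma G_lip x r y s : lo <= r <= hi -> lo <= s <= hi ->
  Rabs (G y s - G x r) <= Rabs (y - x) + 2 * Rabs (s - r).
Proof.
intros Hr Hs.
replace (G y s - G x r) with ((G y s - G x s) + (G x s - G x r)) by ring.
eapply Rle_trans; [apply Rabs_triang|]. apply Rplus_le_compat.
- eapply Rle_trans; [now apply G_lip_x|]. pose proof (Rabs_pos (y - x)); nra.
- destruct (Rle_lt_dec r s) as [L|L].
  + pose proof (G_incr_r x r s ltac:(lra) L ltac:(lra)). rewrite !Rabs_pos_eq; try nra.
  + pose proof (G_incr_r x s r ltac:(lra) ltac:(lra) ltac:(lra)). rewrite !Rabs_left1; try nra.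
Qed.

(** * The clamped radius and the continued generating function *)

Lemma clamped_solution_exists x x' : exists r, lo <= r <= hi /\
  (0 < x' - F x r -> r = hi) /\ (x' - F x r < 0 -> r = lo).
Proof.
destruct (Rle_lt_dec x' (F x lo)) as [L1|L1].
{ exists lo; repeat split; lra. }
destruct (Rle_lt_dec (F x hi) x') as [L2|L2].
{ exists hi; repeat split; lra. }
destruct (Ranalysis5.IVT_interv (fun r => F x r - x') lo hi) as [r [Hr E]]; try lra.
- intros r Hr. apply derivable_continuous_pt. apply derivable_pt_minus.
  + exists (Fr x r). apply is_derive_Reals, F_dr, Hr.
  + apply derivable_pt_const.
- exists r; repeat split; lra.
Qed.

(* The radius [r] in [lo, hi] whose image angle [F x r] is closest to [x']. *)
Definition clamped_radius (x x' : R) : R :=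
  proj1_sig (constructive_indefinite_description _ (clamped_solution_exists x x')).
Definition angle_excess (x x' : R) : R := x' - F x (clamped_radius x x').

Notation rho := clamped_radius.
Notation exc := angle_excess.

Lemma clamped_radius_spec x x' : lo <= rho x x' <= hi /\
  (0 < exc x x' -> rho x x' = hi) /\ (exc x x' < 0 -> rho x x' = lo).
Proof.
unfold angle_excess, clamped_radius.
apply (proj2_sig (constructive_indefinite_description _ (clamped_solution_exists x x'))).
Qed.

(** The smaller radius is not [hi] and the larger is not [lo], so complementarity fixes both signs.
    The estimates below use this in place of a case distinction over the two edges. *)
Lemma excess_opposite x x' y y' : rho x x' < rho y y' -> exc x x' <= 0 <= exc y y'.
Proof.
intros L.
pose proof (clamped_radius_spec x x') as [A1 [A2 A3]].
pose proof (clamped_radius_spec y y') as [B1 [B2 B3]].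
split; apply Rnot_lt_le; intros E; [rewrite A2 in L by lra | rewrite B3 in L by lra]; lra.
Qed.

Lemma clamped_radius_unique x x' r : lo <= r <= hi ->
  (0 < x' - F x r -> r = hi) -> (x' - F x r < 0 -> r = lo) -> rho x x' = r.
Proof.
intros Hr P N.
pose proof (clamped_radius_spec x x') as [A1 [A2 A3]]. unfold angle_excess in *.
set (s := rho x x') in *.
destruct (Rtotal_order s r) as [L|[E|L]]; [exfalso|exact E|exfalso].
- pose proof (F_incr_r x s r ltac:(lra) ltac:(lra) ltac:(lra)).
  assert (0 < c * (r - s)) by (apply Rmult_lt_0_compat; lra).
  destruct (Rle_lt_dec (x' - F x s) 0); [apply Rlt_not_le in L; apply L; rewrite N; lra|].
  rewrite A2 in L; lra.
- pose proof (F_incr_r x r s ltac:(lra) ltac:(lra) ltac:(lra)).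
  assert (0 < c * (s - r)) by (apply Rmult_lt_0_compat; lra).
  destruct (Rle_lt_dec 0 (x' - F x s)); [apply Rlt_not_le in L; apply L; rewrite P; lra|].
  rewrite A3 in L; lra.
Qed.

Lemma clamped_radius_per x x' : rho (x + 2 * PI) (x' + 2 * PI) = rho x x'.
Proof.
pose proof (clamped_radius_spec x x') as [A1 [A2 A3]]. unfold angle_excess in *.
apply clamped_radius_unique; [exact A1 | |]; rewrite F_per by exact A1; intros E;
  [apply A2 | apply A3]; lra.
Qed.

Lemma angle_excess_per x x' : exc (x + 2 * PI) (x' + 2 * PI) = exc x x'.
Proof.
unfold angle_excess. rewrite clamped_radius_per, F_per; [ring|]. apply clamped_radius_spec.
Qed.

Lemma clamped_two_points_lt x x' y y' : rho x x' < rho y y' ->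
  c * (rho y y' - rho x x') + (exc y y' - exc x x') <= Rabs (y' - x') + 2 * Rabs (y - x).
Proof.
intros L.
pose proof (clamped_radius_spec x x') as [A1 _].
pose proof (clamped_radius_spec y y') as [B1 _].
pose proof (F_incr_r x (rho x x') (rho y y') ltac:(lra) ltac:(lra) ltac:(lra)) as E1.
pose proof (F_lip_x x y (rho y y') ltac:(lra)) as E2. apply Rabs_le_between in E2.
pose proof (Rle_abs (y' - x')).
unfold angle_excess. lra.
Qed.

(** In x' = F x rho + exc, an increase of the radius never goes with a decrease of the excess, so
    one bound controls both. The last clause holds because excesses of opposite sign are each
    bounded by their difference. It is what handles two different radii, as [Fx_lip] and [Gx_lip]
    compare angles at equal radius. *)
Lemma clamped_two_points x x' y y' :
  let D := Rabs (y' - x') + 2 * Rabs (y - x) in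
  c * Rabs (rho y y' - rho x x') <= D /\ Rabs (exc y y' - exc x x') <= D /\
  (rho x x' <> rho y y' -> Rabs (exc x x') <= D /\ Rabs (exc y y') <= D).
Proof.
intros D.
assert (D0 : 0 <= D).
{ unfold D. pose proof (Rabs_pos (y' - x')); pose proof (Rabs_pos (y - x)); lra. }
destruct (Rtotal_order (rho x x') (rho y y')) as [L|[E|L]].
- pose proof (clamped_two_points_lt _ _ _ _ L) as A. fold D in A.
  pose proof (excess_opposite _ _ _ _ L) as O.
  assert (0 < c * (rho y y' - rho x x')) by (apply Rmult_lt_0_compat; lra).
  rewrite (Rabs_pos_eq (rho y y' - rho x x')), (Rabs_pos_eq (exc y y' - exc x x')),
    (Rabs_left1 (exc x x')), (Rabs_pos_eq (exc y y')) by lra.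
  repeat split; lra.
- rewrite E, Rminus_diag, Rabs_R0, Rmult_0_r. repeat split; try easy.
  pose proof (clamped_radius_spec y y') as [B1 _].
  unfold angle_excess; rewrite E.
  pose proof (F_lip_x x y (rho y y') B1) as E2.
  replace (y' - F y (rho y y') - (x' - F x (rho y y')))
    with ((y' - x') + - (F y (rho y y') - F x (rho y y'))) by ring.
  eapply Rle_trans; [apply Rabs_triang|]. rewrite Rabs_Ropp. unfold D; lra.
- pose proof (clamped_two_points_lt _ _ _ _ L) as A.
  rewrite (Rabs_minus_sym x'), (Rabs_minus_sym x) in A. fold D in A.
  pose proof (excess_opposite _ _ _ _ L) as O.
  assert (0 < c * (rho x x' - rho y y')) by (apply Rmult_lt_0_compat; lra).
  rewrite (Rabs_left1 (rho y y' - rho x x')), (Rabs_left1 (exc y y' - exc x x')),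
    (Rabs_left1 (exc y y')), (Rabs_pos_eq (exc x x')) by lra.
  repeat split; lra.
Qed.

(* On the image of the strip this is [V], written as a function of the initial and final
   angles; beyond it, a second order Taylor continuation in the excess with leading
   coefficient 1/2, which keeps the mixed derivative nonpositive. *)
Definition gen_fun (x x' : R) : R :=
  V x (rho x x') + G x (rho x x') * exc x x' + exc x x' ^ 2 / 2.
(** Exactness reads dV = G dF - r dx, so where the excess vanishes the partial derivatives are minus
    the initial radius and the final radius. The terms in the excess come from differentiating the
    continuation at a fixed edge radius. *)
Definition gen_fun_d1 (x x' : R) : R :=
  - rho x x' - exc x x' * (Fx x (rho x x') - Gx x (rho x x')).
Definition gen_fun_d2 (x x' : R) : R := G x (rho x x') + exc x x'.

Lemma gen_fun_per x x' : gen_fun (x + 2 * PI) (x' + 2 * PI) = gen_fun x x'.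
Proof.
unfold gen_fun. pose proof (clamped_radius_spec x x') as [A _].
now rewrite clamped_radius_per, angle_excess_per, V_per, G_per.
Qed.

Lemma gen_fun_d2_per x x' : gen_fun_d2 (x + 2 * PI) (x' + 2 * PI) = gen_fun_d2 x x'.
Proof.
unfold gen_fun_d2. pose proof (clamped_radius_spec x x') as [A _].
now rewrite clamped_radius_per, angle_excess_per, G_per.
Qed.

Lemma is_derive_per (f : R -> R) (x l l' k : R) :
  (forall t, f (t + 2 * PI) = f t + k) ->
  is_derive f x l -> is_derive f (x + 2 * PI) l' -> l' = l.
Proof.
intros Hf Hl Hl'.
assert (E : is_derive (fun t => f (t + 2 * PI)) x l').
{ replace l' with (1 * l') by ring.
  apply (is_derive_comp f (fun t => t + 2 * PI) x l' 1); [exact Hl'|]. auto_derive; [easy|ring]. }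
apply (is_derive_ext _ (fun t => f t + k)) in E; [|exact Hf].
apply is_derive_unique in E. rewrite <- E. apply is_derive_unique.
replace l with (l + 0) by ring. apply @is_derive_plus; [exact Hl | apply @is_derive_const].
Qed.

Lemma gen_fun_d1_per x x' : gen_fun_d1 (x + 2 * PI) (x' + 2 * PI) = gen_fun_d1 x x'.
Proof.
unfold gen_fun_d1. pose proof (clamped_radius_spec x x') as [A _].
rewrite clamped_radius_per, angle_excess_per.
assert (E1 : Fx (x + 2 * PI) (rho x x') = Fx x (rho x x')).
{ apply (is_derive_per (fun t => F t (rho x x')) x _ _ (2 * PI)); [| now apply F_dx | now apply F_dx].
  intros; now apply F_per. }
assert (E2 : Gx (x + 2 * PI) (rho x x') = Gx x (rho x x')).
{ apply (is_derive_per (fun t => G t (rho x x')) x _ _ 0); [| now apply G_dx | now apply G_dx].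
  intros; rewrite G_per by exact A; ring. }
now rewrite E1, E2.
Qed.

(** Radius and excess are both nondecreasing in the final angle, and the factor Fx - Gx is
    nonnegative. If the radius changes, the two factors differ, but then the excess passes from
    nonpositive to nonnegative. *)
Lemma gen_fun_d1_anti x x' y' : x' <= y' -> gen_fun_d1 x y' <= gen_fun_d1 x x'.
Proof.
intros L. unfold gen_fun_d1.
pose proof (clamped_radius_spec x x') as [A1 _].
pose proof (clamped_radius_spec x y') as [B1 _].
assert (K : forall r, lo <= r <= hi -> 0 <= Fx x r - Gx x r).
{ intros r Hr. pose proof (Fx_near x r Hr) as E1. pose proof (Gx_near x r Hr) as E2.
  apply Rabs_le_between in E1. apply Rabs_le_between in E2. lra. }
pose proof (K _ A1) as K1. pose proof (K _ B1) as K2.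
destruct (Rtotal_order (rho x x') (rho x y')) as [H|[E|H]].
- pose proof (excess_opposite _ _ _ _ H). nra.
- assert (exc x x' <= exc x y') by (unfold angle_excess; rewrite E; lra).
  rewrite E; nra.
- exfalso. pose proof (excess_opposite _ _ _ _ H) as O. unfold angle_excess in O.
  pose proof (F_incr_r x (rho x y') (rho x x') ltac:(lra) ltac:(lra) ltac:(lra)).
  assert (0 < c * (rho x x' - rho x y')) by (apply Rmult_lt_0_compat; lra). lra.
Qed.

(** Raising the initial angle cannot raise the radius, by the twist. At equal radii the excess falls
    by at least (y - x) / 2 while G gains at most eta (y - x). If the radius falls by d, the loss (1
    - eta) d in G and the fall of the excess absorb that gain; this is the purpose of [eta_C]. *)
Lemma gen_fun_d2_anti x y x' : x <= y -> gen_fun_d2 y x' <= gen_fun_d2 x x'.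
Proof.
intros L. unfold gen_fun_d2.
pose proof (clamped_radius_spec x x') as [A1 _].
pose proof (clamped_radius_spec y x') as [B1 _].
pose proof (G_lip_x x y (rho y x') B1) as Gl. rewrite (Rabs_pos_eq (y - x)) in Gl by lra.
apply Rabs_le_between in Gl.
pose proof (F_incr_x x y (rho y x') B1 L) as Fi.
destruct (Rtotal_order (rho x x') (rho y x')) as [H|[E|H]].
- exfalso. pose proof (excess_opposite _ _ _ _ H) as O. unfold angle_excess in O.
  pose proof (F_incr_r x (rho x x') (rho y x') ltac:(lra) ltac:(lra) ltac:(lra)).
  assert (0 < c * (rho y x' - rho x x')) by (apply Rmult_lt_0_compat; lra). lra.
- unfold angle_excess; rewrite E in *. nra.
- pose proof (excess_opposite _ _ _ _ H) as O. unfold angle_excess in *.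
  set (r1 := rho x x') in *. set (r2 := rho y x') in *.
  pose proof (F_incr_r x r2 r1 ltac:(lra) ltac:(lra) ltac:(lra)) as Fr'.
  pose proof (G_incr_r x r2 r1 ltac:(lra) ltac:(lra) ltac:(lra)) as Gr'.
  set (d := r1 - r2) in *. assert (0 < d) by (unfold d; lra).
  (* The fall of the excess between the two pairs; F bounds y - x in terms of d and e. *)
  set (e := F y r2 - F x r1). assert (0 <= e) by (unfold e; lra).
  assert (Y : y - x <= 2 * (C * d) + 2 * e) by (unfold e; lra).
  apply (Rmult_le_compat_l eta) in Y; [|exact eta_pos].
  assert (eta * (1 + 2 * C) * d <= 1 * d) by (apply Rmult_le_compat_r; lra).
  assert (eta * e <= / 4 * e) by (apply Rmult_le_compat_r; lra).
  assert (Z : G y r2 - G x r1 <= e); [|unfold e in Z; lra]. nra.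
Qed.



(** With G0 and r0 the values at the starting point, d(V - G0 F + r0 x) = (G - G0) dF - (r - r0) dx,
    which is of second order. It is integrated in the angle at radius r, then in the radius at angle
    y. *)
Lemma V_increment x r y s : lo <= r <= hi -> lo <= s <= hi ->
  Rabs (V y s - V x r - G x r * (F y s - F x r) + r * (y - x))
    <= C * (Rabs (y - x) + 2 * Rabs (s - r)) * Rabs (s - r) + 2 * Rabs (y - x) * Rabs (y - x).
Proof.
intros Hr Hs.
assert (E1 : Rabs ((V y s - G x r * F y s) - (V y r - G x r * F y r))
   <= C * (Rabs (y - x) + 2 * Rabs (s - r)) * Rabs (s - r)).
{ assert (HB : forall t, Rmin r s <= t <= Rmax r s -> lo <= t <= hi).
  { intros t; unfold Rmin, Rmax; repeat destruct Rle_dec; lra. }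
  apply (is_derive_increment_Rabs (fun t => V y t - G x r * F y t)
           (fun t => G y t * Fr y t - G x r * Fr y t)).
  - intros t Ht. specialize (HB t Ht).
    apply @is_derive_minus; [now apply V_dr|]. apply is_derive_scal. now apply F_dr.
  - intros t Ht. pose proof (HB t Ht) as Ht'.
    replace (G y t * Fr y t - G x r * Fr y t) with (Fr y t * (G y t - G x r)) by ring.
    rewrite Rabs_mult. pose proof (Fr_bounds y t Ht') as Hf.
    apply Rmult_le_compat; try apply Rabs_pos; [rewrite Rabs_pos_eq; lra|].
    eapply Rle_trans; [now apply G_lip|].
    pose proof (Rabs_between_le r s t Ht). lra. }
assert (E2 : Rabs ((V y r - G x r * F y r + r * y) - (V x r - G x r * F x r + r * x))
   <= 2 * Rabs (y - x) * Rabs (y - x)).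
{ apply (is_derive_increment_Rabs (fun t => V t r - G x r * F t r + r * t)
           (fun t => (G t r * Fx t r - r) - G x r * Fx t r + r * 1)).
  - intros t Ht. apply @is_derive_plus; [apply @is_derive_minus|].
    + now apply V_dx.
    + apply is_derive_scal. now apply F_dx.
    + apply is_derive_scal. apply @is_derive_id.
  - intros t Ht.
    replace (G t r * Fx t r - r - G x r * Fx t r + r * 1) with (Fx t r * (G t r - G x r)) by ring.
    rewrite Rabs_mult. pose proof (Fx_near t r Hr) as Hf. apply Rabs_le_between in Hf.
    apply Rmult_le_compat; try apply Rabs_pos; [rewrite Rabs_pos_eq; lra|].
    eapply Rle_trans; [now apply G_lip_x|].
    pose proof (Rabs_between_le x y t Ht). pose proof (Rabs_pos (t - x)). nra. }
replace (V y s - V x r - G x r * (F y s - F x r) + r * (y - x)) with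
  (((V y s - G x r * F y s) - (V y r - G x r * F y r))
   + ((V y r - G x r * F y r + r * y) - (V x r - G x r * F x r + r * x))) by ring.
eapply Rle_trans; [apply Rabs_triang|]. lra.
Qed.

Lemma F_expand_x x y r : lo <= r <= hi ->
  Rabs (F y r - F x r - Fx x r * (y - x)) <= Rabs (y - x) * Rabs (y - x).
Proof.
intros Hr.
replace (F y r - F x r - Fx x r * (y - x)) with ((F y r - Fx x r * y) - (F x r - Fx x r * x)) by ring.
apply (is_derive_increment_Rabs (fun t => F t r - Fx x r * t) (fun t => Fx t r - Fx x r * 1)).
- intros t Ht. apply @is_derive_minus; [now apply F_dx|]. apply is_derive_scal. apply @is_derive_id.
- intros t Ht. rewrite Rmult_1_r. eapply Rle_trans; [now apply Fx_lip|]. now apply Rabs_between_le.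
Qed.

Lemma G_expand_x x y r : lo <= r <= hi ->
  Rabs (G y r - G x r - Gx x r * (y - x)) <= Rabs (y - x) * Rabs (y - x).
Proof.
intros Hr.
replace (G y r - G x r - Gx x r * (y - x)) with ((G y r - Gx x r * y) - (G x r - Gx x r * x)) by ring.
apply (is_derive_increment_Rabs (fun t => G t r - Gx x r * t) (fun t => Gx t r - Gx x r * 1)).
- intros t Ht. apply @is_derive_minus; [now apply G_dx|]. apply is_derive_scal. apply @is_derive_id.
- intros t Ht. rewrite Rmult_1_r. eapply Rle_trans; [now apply Gx_lip|]. now apply Rabs_between_le.
Qed.

(** * Lipschitz and second order bounds for the generating function *)

Variable E : R.
Hypothesis E_pos : 0 <= E.

(** The sum of the four quadratic bounds in [gen_fun_expand_aux]; it also dominates both Lipschitz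
    constants. [E] bounds the excess. *)
Let K := (1 + 2 * / c) * (C * / c) + 2 * E + 10 + 4 * / c + C * / c.

Let ic_pos : 0 < / c.
Proof. now apply Rinv_0_lt_compat. Qed.

Let Cic_pos : 0 < C * / c.
Proof. now apply Rmult_lt_0_compat. Qed.

Lemma clamped_radius_lip x x' y y' :
  Rabs (rho y y' - rho x x') <= / c * (Rabs (y' - x') + 2 * Rabs (y - x)).
Proof.
destruct (clamped_two_points x x' y y') as [A _].
apply (Rmult_le_compat_l (/ c)) in A; [|lra].
rewrite <- Rmult_assoc, Rinv_l, Rmult_1_l in A by lra. exact A.
Qed.

Lemma gen_fun_d2_lip_aux x x' y y' :
  Rabs (gen_fun_d2 y y' - gen_fun_d2 x x') <= K * (Rabs (y' - x') + 2 * Rabs (y - x)).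
Proof.
pose proof (clamped_two_points x x' y y') as [_ [A _]].
pose proof (clamped_radius_lip x x' y y') as B.
pose proof (clamped_radius_spec x x') as [S1 _].
pose proof (clamped_radius_spec y y') as [S2 _].
pose proof (G_lip x (rho x x') y (rho y y') S1 S2) as Gl.
pose proof (Rabs_pos (y - x)). pose proof (Rabs_pos (y' - x')).
set (D := Rabs (y' - x') + 2 * Rabs (y - x)) in *.
assert (Rabs (y - x) <= D) by (unfold D; lra).
unfold gen_fun_d2.
replace (G y (rho y y') + exc y y' - (G x (rho x x') + exc x x')) with
  ((G y (rho y y') - G x (rho x x')) + (exc y y' - exc x x')) by ring.
eapply Rle_trans; [apply Rabs_triang|].
apply Rle_trans with ((2 + 2 * / c) * D); [lra|].
apply Rmult_le_compat_r; [lra|]. unfold K. nra.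
Qed.

Lemma gen_fun_d1_lip_aux x x' y y' : Rabs (exc x x') <= E -> Rabs (exc y y') <= E ->
  Rabs (gen_fun_d1 y y' - gen_fun_d1 x x') <= K * (Rabs (y' - x') + 2 * Rabs (y - x)).
Proof.
intros Ex Ey.
pose proof (clamped_two_points x x' y y') as [_ [A A']].
pose proof (clamped_radius_lip x x' y y') as B.
pose proof (clamped_radius_spec x x') as [S1 _].
pose proof (clamped_radius_spec y y') as [S2 _].
pose proof (Rabs_pos (y - x)). pose proof (Rabs_pos (y' - x')).
set (D := Rabs (y' - x') + 2 * Rabs (y - x)) in *.
assert (HD : Rabs (y - x) <= D) by (unfold D; lra).
assert (Kb : forall t r, lo <= r <= hi -> Rabs (Fx t r - Gx t r) <= 2).
{ intros t r Hr. pose proof (Fx_near t r Hr) as E1. pose proof (Gx_near t r Hr) as E2.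
  apply Rabs_le_between in E1. apply Rabs_le_between in E2. apply Rabs_le. lra. }
pose proof (Kb x _ S1) as K1. pose proof (Kb y _ S2) as K2.
assert (P : Rabs (exc y y' * (Fx y (rho y y') - Gx y (rho y y'))
                  - exc x x' * (Fx x (rho x x') - Gx x (rho x x'))) <= (4 + 2 * E) * D).
(* At equal radii the Lipschitz bounds in the angle apply; otherwise both excesses are themselves at
   most D. *)
{ destruct (Req_dec (rho x x') (rho y y')) as [Er|Nr].
  - pose proof (Fx_lip x y (rho y y') S2) as L1. pose proof (Gx_lip x y (rho y y') S2) as L2.
    rewrite Er in *. set (r := rho y y') in *.
    replace (exc y y' * (Fx y r - Gx y r) - exc x x' * (Fx x r - Gx x r)) with
      ((exc y y' - exc x x') * (Fx y r - Gx y r)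
       + exc x x' * ((Fx y r - Fx x r) - (Gx y r - Gx x r))) by ring.
    eapply Rle_trans; [apply Rabs_triang|]. rewrite !Rabs_mult.
    apply Rle_trans with (D * 2 + E * (2 * D)).
    + apply Rplus_le_compat; apply Rmult_le_compat; try apply Rabs_pos; try assumption.
      unfold Rminus at 1. eapply Rle_trans; [apply Rabs_triang|]. rewrite Rabs_Ropp. lra.
    + nra.
  - destruct (A' Nr) as [X1 X2].
    unfold Rminus at 1. eapply Rle_trans; [apply Rabs_triang|]. rewrite Rabs_Ropp, !Rabs_mult.
    apply Rle_trans with (D * 2 + D * 2).
    + apply Rplus_le_compat; apply Rmult_le_compat; try apply Rabs_pos; assumption.
    + nra. }
unfold gen_fun_d1.
match goal with |- Rabs ?z <= _ => replace z with (- (rho y y' - rho x x')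
   + - (exc y y' * (Fx y (rho y y') - Gx y (rho y y'))
        - exc x x' * (Fx x (rho x x') - Gx x (rho x x')))) by ring end.
eapply Rle_trans; [apply Rabs_triang|]. rewrite !Rabs_Ropp.
apply Rle_trans with ((/ c + (4 + 2 * E)) * D); [lra|].
apply Rmult_le_compat_r; [lra|]. unfold K. nra.
Qed.

(** Substituting y' - x' as the increment of F plus that of the excess cancels the linear part. What
    remains is the increment of V, a product of increments, half a squared increment, and the excess
    times Taylor remainders of G and F. *)
Lemma gen_fun_expand_aux x x' y y' : Rabs (exc x x') <= E ->
  Rabs (gen_fun y y' - gen_fun x x' - gen_fun_d1 x x' * (y - x) - gen_fun_d2 x x' * (y' - x'))
    <= K * ((Rabs (y' - x') + 2 * Rabs (y - x)) * (Rabs (y' - x') + 2 * Rabs (y - x))).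
Proof.
intros Ex.
pose proof (clamped_two_points x x' y y') as [_ [A A']].
pose proof (clamped_radius_lip x x' y y') as B.
pose proof (clamped_radius_spec x x') as [S1 _].
pose proof (clamped_radius_spec y y') as [S2 _].
pose proof (Rabs_pos (y - x)) as P1. pose proof (Rabs_pos (y' - x')) as P2.
set (D := Rabs (y' - x') + 2 * Rabs (y - x)) in *.
assert (HD : Rabs (y - x) <= D) by (unfold D; lra).
assert (Y' : y' - x' = F y (rho y y') - F x (rho x x') + (exc y y' - exc x x'))
  by (unfold angle_excess; ring).
pose proof (V_increment x (rho x x') y (rho y y') S1 S2) as HV.
pose proof (G_lip x (rho x x') y (rho y y') S1 S2) as HG.
assert (HG' : Rabs (G y (rho y y') - G x (rho x x')) <= (1 + 2 * / c) * D) by lra.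
(* At equal radii the remainders are quadratic in y - x. At different radii they are only of order
   D, but so is the excess in front. *)
assert (Q : Rabs (exc x x' * ((G y (rho y y') - G x (rho x x') - Gx x (rho x x') * (y - x))
      - (F y (rho y y') - F x (rho x x') - Fx x (rho x x') * (y - x))))
   <= (2 * E + 6 + 2 * / c + C * / c) * (D * D)).
{ rewrite Rabs_mult. destruct (Req_dec (rho x x') (rho y y')) as [Er|Nr].
  - pose proof (F_expand_x x y (rho y y') S2) as L1. pose proof (G_expand_x x y (rho y y') S2) as L2.
    rewrite <- Er in L1, L2. rewrite <- Er.
    apply Rle_trans with (E * (2 * (D * D))).
    + apply Rmult_le_compat; try apply Rabs_pos; [assumption|].
      unfold Rminus at 1. eapply Rle_trans; [apply Rabs_triang|]. rewrite Rabs_Ropp. nra.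
    + assert (0 <= D * D) by nra. nra.
  - destruct (A' Nr) as [X1 X2].
    assert (HF : Rabs (F y (rho y y') - F x (rho x x')) <= (2 + C * / c) * D).
    { replace (F y (rho y y') - F x (rho x x')) with
        ((F y (rho y y') - F x (rho y y')) + (F x (rho y y') - F x (rho x x'))) by ring.
      eapply Rle_trans; [apply Rabs_triang|].
      pose proof (F_lip_x x y (rho y y') S2). pose proof (F_lip_r x (rho x x') (rho y y') S1 S2).
      apply (Rmult_le_compat_l C) in B; lra. }
    assert (H1 : Rabs (Gx x (rho x x') * (y - x)) <= D).
    { rewrite Rabs_mult. pose proof (Gx_near x _ S1). pose proof (Rabs_pos (Gx x (rho x x'))). nra. }
    assert (H2 : Rabs (Fx x (rho x x') * (y - x)) <= 2 * D).
    { rewrite Rabs_mult. pose proof (Fx_near x _ S1) as N. apply Rabs_le_between in N.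
      apply Rmult_le_compat; try apply Rabs_pos; [rewrite Rabs_pos_eq; lra | lra]. }
    apply Rle_trans with (D * ((6 + 2 * / c + C * / c) * D)).
    + apply Rmult_le_compat; try apply Rabs_pos; [assumption|].
      unfold Rminus at 1. eapply Rle_trans; [apply Rabs_triang|]. rewrite Rabs_Ropp.
      unfold Rminus at 1 3. eapply Rle_trans; [apply Rplus_le_compat; apply Rabs_triang|].
      rewrite !Rabs_Ropp. unfold Rminus in *. lra.
    + assert (0 <= D * D) by nra. nra. }
assert (HV' : Rabs (V y (rho y y') - V x (rho x x') - G x (rho x x') * (F y (rho y y') - F x (rho x x'))
     + rho x x' * (y - x)) <= ((1 + 2 * / c) * (C * / c) + 2) * (D * D)).
{ eapply Rle_trans; [exact HV|].
  pose proof (Rabs_pos (rho y y' - rho x x')) as P3.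
  assert (X1 : (Rabs (y - x) + 2 * Rabs (rho y y' - rho x x')) * Rabs (rho y y' - rho x x')
     <= ((1 + 2 * / c) * D) * (/ c * D)) by (apply Rmult_le_compat; lra).
  assert (X2 : Rabs (y - x) * Rabs (y - x) <= D * D) by (apply Rmult_le_compat; lra).
  apply (Rmult_le_compat_l C) in X1; lra. }
assert (HGe : Rabs ((G y (rho y y') - G x (rho x x')) * (exc y y' - exc x x'))
    <= (1 + 2 * / c) * (D * D)).
{ rewrite Rabs_mult, <- Rmult_assoc. apply Rmult_le_compat; try apply Rabs_pos; assumption. }
assert (He : Rabs ((exc y y' - exc x x') * (exc y y' - exc x x') * / 2) <= D * D).
{ rewrite !Rabs_mult, (Rabs_pos_eq (/ 2)) by lra.
  pose proof (Rabs_pos (exc y y' - exc x x')). nra. }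
unfold gen_fun, gen_fun_d1, gen_fun_d2. rewrite Y'.
match goal with |- Rabs ?z <= _ => replace z with
  (((V y (rho y y') - V x (rho x x') - G x (rho x x') * (F y (rho y y') - F x (rho x x'))
     + rho x x' * (y - x))
   + (G y (rho y y') - G x (rho x x')) * (exc y y' - exc x x'))
   + ((exc y y' - exc x x') * (exc y y' - exc x x') * / 2
   + exc x x' * ((G y (rho y y') - G x (rho x x') - Gx x (rho x x') * (y - x))
      - (F y (rho y y') - F x (rho x x') - Fx x (rho x x') * (y - x))))) by field end.
eapply Rle_trans; [apply Rabs_triang|].
eapply Rle_trans; [apply Rplus_le_compat; apply Rabs_triang|].
unfold K. lra.
Qed.


(** * Critical configurations and their confinement *)

Variables (D0 B r0 d kappa : R) (m1 : nat) (m2 : Z) (N : nat).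
Hypothesis m1_pos : (0 < m1)%nat.
Hypothesis F_displacement : forall x r, lo <= r <= hi -> Rabs (F x r - x) <= D0.
Hypothesis G_displacement : forall x r, lo <= r <= hi -> Rabs (G x r - r) <= eta.
Hypothesis B_large : Rabs (2 * PI * IZR m2 / INR m1) + 4 * PI <= B.
Hypothesis E_def : E = B + D0.
Hypothesis d_pos : 0 < d.
Hypothesis r0_lo : lo <= r0 - 2 * d.
Hypothesis r0_hi : r0 + 2 * d <= hi.
Hypothesis F_above : forall x r, r0 + d <= r <= hi ->
  2 * PI * IZR m2 / INR m1 + kappa <= F x r - x.
Hypothesis F_below : forall x r, lo <= r <= r0 - d ->
  F x r - x <= 2 * PI * IZR m2 / INR m1 - kappa.
Hypothesis N_kappa : 2 * PI < INR N * kappa.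
Hypothesis N_drift : INR N * ((2 * E + 1) * eta) <= d.

Lemma angle_excess_bounded x x' : Rabs (x' - x) <= B -> Rabs (exc x x') <= E.
Proof.
intros Hx. pose proof (clamped_radius_spec x x') as [S1 _].
pose proof (F_displacement x _ S1) as H.
unfold angle_excess. replace (x' - F x (rho x x')) with ((x' - x) + - (F x (rho x x') - x)) by ring.
eapply Rle_trans; [apply Rabs_triang|]. rewrite Rabs_Ropp. lra.
Qed.

(** From (t + 2 s)^2 <= 5 (s^2 + t^2). *)
Let L := 5 * K.

Let K_pos : 0 < K.
Proof. unfold K. nra. Qed.

Lemma gen_fun_critical_pair :
  exists u z, rot_class m1 u /\ rot_class m1 z /\
    (forall q, chain_force gen_fun_d1 gen_fun_d2 m2 u q = 0) /\
    (forall q, chain_force gen_fun_d1 gen_fun_d2 m2 z q = 0) /\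
    (forall q, u q <= z q <= u (q + 1)%Z) /\
    (exists q, z q <> u q) /\ (exists q, z q <> u (q + 1)%Z).
Proof.
apply (exists_chain_critical_pair gen_fun gen_fun_d1 gen_fun_d2 B L).
- exact m1_pos.
- unfold L; lra.
- exact gen_fun_per.
- exact gen_fun_d1_per.
- exact gen_fun_d2_per.
- intros x x' y y' Hx Hy. eapply Rle_trans; [apply gen_fun_expand_aux; now apply angle_excess_bounded|].
  unfold L. rewrite (Rmult_comm 5), Rmult_assoc. apply Rmult_le_compat_l; [lra|].
  rewrite <- (pow2_abs (y - x)), <- (pow2_abs (y' - x')).
  set (s := Rabs (y - x)); set (t := Rabs (y' - x')).
  pose proof (pow2_ge_0 (s - 2 * t)). nra.
- intros x x' y y' Hx Hy. eapply Rle_trans; [apply gen_fun_d1_lip_aux; now apply angle_excess_bounded|].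
  unfold L. pose proof (Rabs_pos (y - x)); pose proof (Rabs_pos (y' - x')). nra.
- intros x x' y y' Hx Hy. eapply Rle_trans; [apply gen_fun_d2_lip_aux|].
  unfold L. pose proof (Rabs_pos (y - x)); pose proof (Rabs_pos (y' - x')). nra.
- exact gen_fun_d1_anti.
- exact gen_fun_d2_anti.
- exact B_large.
Qed.

Section Confinement.

Variable u : Z -> R.
Hypothesis u_class : rot_class m1 u.
Hypothesis u_crit : forall q, chain_force gen_fun_d1 gen_fun_d2 m2 u q = 0.

Let p q := rho (u q) (u (q + m2)%Z).
Let e q := exc (u q) (u (q + m2)%Z).

Lemma critical_next_angle q : u (q + m2)%Z = F (u q) (p q) + e q.
Proof. unfold p, e, angle_excess. ring. Qed.

(** The Euler-Lagrange equation equates the final momentum of one bond with the initial momentum of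
    the next. Without excess this is the second component of the map. *)
Lemma critical_momentum q :
  p (q + m2)%Z + e (q + m2)%Z * (Fx (u (q + m2)%Z) (p (q + m2)%Z) - Gx (u (q + m2)%Z) (p (q + m2)%Z))
  = G (u q) (p q) + e q.
Proof.
pose proof (u_crit (q + m2)%Z) as Hq. unfold chain_force in Hq.
replace (q + m2 - m2)%Z with q in Hq by lia.
unfold gen_fun_d1, gen_fun_d2 in Hq. fold (p (q + m2)%Z) (e (q + m2)%Z) (p q) (e q) in Hq. lra.
Qed.

Lemma excess_le_E q : Rabs (e q) <= E.
Proof.
apply angle_excess_bounded.
apply (rot_class_bond_self B m1 m2 m1_pos B_large u u_class).
Qed.

(** The clamped [p] loses information at the edges, so the sum p + e is followed. Replacing Fx - Gx
    by 1 costs 2 eta E, and G moves the radius by at most eta. *)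
Lemma momentum_drift q :
  Rabs ((p (q + m2)%Z + e (q + m2)%Z) - (p q + e q)) <= (2 * E + 1) * eta.
Proof.
pose proof (critical_momentum q) as M.
pose proof (clamped_radius_spec (u q) (u (q + m2)%Z)) as [S1 _]. fold (p q) in S1.
pose proof (clamped_radius_spec (u (q + m2)%Z) (u (q + m2 + m2)%Z)) as [S2 _].
fold (p (q + m2)%Z) in S2.
pose proof (G_displacement (u q) _ S1) as HG.
pose proof (Fx_near (u (q + m2)%Z) _ S2) as H1. pose proof (Gx_near (u (q + m2)%Z) _ S2) as H2.
pose proof (excess_le_E (q + m2)%Z) as He.
set (k1 := Fx (u (q + m2)%Z) (p (q + m2)%Z)) in *. set (k2 := Gx (u (q + m2)%Z) (p (q + m2)%Z)) in *.
replace (p (q + m2)%Z + e (q + m2)%Z - (p q + e q)) with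
  (e (q + m2)%Z * (- (k1 - 1) + k2) + (G (u q) (p q) - p q)) by lra.
eapply Rle_trans; [apply Rabs_triang|]. rewrite Rabs_mult.
assert (Rabs (- (k1 - 1) + k2) <= 2 * eta).
{ eapply Rle_trans; [apply Rabs_triang|]. rewrite Rabs_Ropp. lra. }
assert (Rabs (e (q + m2)%Z) * Rabs (- (k1 - 1) + k2) <= E * (2 * eta)).
{ apply Rmult_le_compat; try apply Rabs_pos; assumption. }
lra.
Qed.

Lemma momentum_drift_iter q k : Rabs ((p (q + Z.of_nat k * m2)%Z + e (q + Z.of_nat k * m2)%Z) - (p q + e q))
  <= INR k * ((2 * E + 1) * eta).
Proof.
induction k as [|k IH].
- replace (q + Z.of_nat 0 * m2)%Z with q by lia. rewrite Rminus_diag, Rabs_R0. simpl; lra.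
- pose proof (momentum_drift (q + Z.of_nat k * m2)%Z) as D.
  replace (q + Z.of_nat k * m2 + m2)%Z with (q + Z.of_nat (S k) * m2)%Z in D by lia.
  rewrite S_INR.
  apply Rabs_le_between in D. apply Rabs_le_between in IH. apply Rabs_le. lra.
Qed.

Lemma excess_cases q : (e q = 0) \/ (0 < e q /\ p q = hi) \/ (e q < 0 /\ p q = lo).
Proof.
pose proof (clamped_radius_spec (u q) (u (q + m2)%Z)) as [S1 [S2 S3]].
fold (p q) (e q) in S1, S2, S3.
destruct (Rtotal_order (e q) 0) as [H|[H|H]]; auto.
Qed.

(* A large momentum can only drift slowly, hence stays large for [N] steps; the angle then
   outruns the rotation number by more than the [2 * PI] allowed by monotonicity. *)
Lemma momentum_confined q : r0 - 2 * d < p q + e q < r0 + 2 * d.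
Proof.
assert (Drift : forall k, (k <= N)%nat ->
  p q + e q - d <= p (q + Z.of_nat k * m2)%Z + e (q + Z.of_nat k * m2)%Z <= p q + e q + d).
{ intros k Hk. pose proof (momentum_drift_iter q k) as D. apply Rabs_le_between in D.
  assert (INR k * ((2 * E + 1) * eta) <= INR N * ((2 * E + 1) * eta)).
  { apply Rmult_le_compat_r; [apply Rmult_le_pos; lra | now apply le_INR]. }
  lra. }
pose proof (rot_class_rotation m1 u m1_pos u_class q (Z.of_nat N * m2)) as Rot.
assert (EqN : 2 * PI * IZR (Z.of_nat N * m2) / INR m1 = INR N * (2 * PI * IZR m2 / INR m1)).
{ rewrite mult_IZR, <- INR_IZR_INZ. field. apply not_0_INR; lia. }
rewrite EqN in Rot. apply Rabs_le_between in Rot.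
set (om := 2 * PI * IZR m2 / INR m1) in *.
assert (Step : forall k, (q + Z.of_nat (S k) * m2 = q + Z.of_nat k * m2 + m2)%Z) by (intros; lia).
split; apply Rnot_le_lt; intros Hs.
(* Here p + e stays below r0 - d for N steps, which excludes a positive excess since then p = hi. A
   negative excess only slows the angle further. *)
- assert (A : forall k, (k <= N)%nat -> u (q + Z.of_nat k * m2)%Z - u q <= INR k * (om - kappa)).
  { intros k; induction k as [|k IH]; intros Hk.
    - replace (q + Z.of_nat 0 * m2)%Z with q by lia. simpl; lra.
    - specialize (IH ltac:(lia)). specialize (Drift k ltac:(lia)). rewrite S_INR, Step.
      rewrite critical_next_angle.
      pose proof (clamped_radius_spec (u (q + Z.of_nat k * m2)%Z) (u (q + Z.of_nat k * m2 + m2)%Z)) as [S1 _].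
      fold (p (q + Z.of_nat k * m2)%Z) in S1.
      set (q' := (q + Z.of_nat k * m2)%Z) in *.
      pose proof (F_below (u q') (p q')) as Fb.
      destruct (excess_cases q') as [H|[[H H']|[H H']]]; lra. }
  specialize (A N (Nat.le_refl N)). lra.
- assert (A : forall k, (k <= N)%nat -> INR k * (om + kappa) <= u (q + Z.of_nat k * m2)%Z - u q).
  { intros k; induction k as [|k IH]; intros Hk.
    - replace (q + Z.of_nat 0 * m2)%Z with q by lia. simpl; lra.
    - specialize (IH ltac:(lia)). specialize (Drift k ltac:(lia)). rewrite S_INR, Step.
      rewrite critical_next_angle.
      pose proof (clamped_radius_spec (u (q + Z.of_nat k * m2)%Z) (u (q + Z.of_nat k * m2 + m2)%Z)) as [S1 _].
      fold (p (q + Z.of_nat k * m2)%Z) in S1.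
      set (q' := (q + Z.of_nat k * m2)%Z) in *.
      pose proof (F_above (u q') (p q')) as Fb.
      destruct (excess_cases q') as [H|[[H H']|[H H']]]; lra. }
  specialize (A N (Nat.le_refl N)). lra.
Qed.

Lemma critical_map_orbit : exists w : Z -> R, map_orbit F G lo hi m2 u w /\
  (forall q, w (q + Z.of_nat m1)%Z = w q).
Proof.
assert (Z0 : forall q, e q = 0).
{ intros q. pose proof (momentum_confined q).
  destruct (excess_cases q) as [H'|[[H' H'']|[H' H'']]]; lra. }
exists p; split.
- intros q. pose proof (momentum_confined q) as Mq. rewrite Z0 in Mq.
  pose proof (critical_next_angle q) as A. pose proof (critical_momentum q) as M.
  rewrite !Z0 in *. repeat split; lra.
- intros q; unfold p. replace (q + Z.of_nat m1 + m2)%Z with (q + m2 + Z.of_nat m1)%Z by lia.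
  destruct u_class as [Hp _]. rewrite !Hp. apply clamped_radius_per.
Qed.

End Confinement.

Lemma twist_map_orbit_pair :
  exists u z p s, rot_class m1 u /\ rot_class m1 z /\
    map_orbit F G lo hi m2 u p /\ map_orbit F G lo hi m2 z s /\
    (forall q, p (q + Z.of_nat m1)%Z = p q) /\ (forall q, s (q + Z.of_nat m1)%Z = s q) /\
    (forall q, u q <= z q <= u (q + 1)%Z) /\
    (exists q, z q <> u q) /\ (exists q, z q <> u (q + 1)%Z).
Proof.
destruct gen_fun_critical_pair as [u [z [Hu [Hz [Cu [Cz Hr]]]]]].
destruct (critical_map_orbit u Hu Cu) as [p [Op Pp]].
destruct (critical_map_orbit z Hz Cz) as [s [Os Ps]].
exists u, z, p, s. now repeat (split; [assumption|]).
Qed.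

End GeneratingFunction.

(** * Perturbations of an integrable twist *)

(** Closeness of (F, G) to the integrable twist (x + al r, r) in C^1, exactness dV = G dF - r dx,
    Lipschitz bounds in the angle, and periodicity. The sign of the twist is left open so that the
    bundle survives the reflection of the radius. *)
Record near_twist (al dal : R -> R) (lo hi eta : R) (F G V Fx Fr Gx Gr : R -> R -> R) : Prop := {
  nt_F_dx : forall x r : R, lo <= r <= hi -> is_derive (fun t => F t r) x (Fx x r);
  nt_F_dr : forall x r : R, lo <= r <= hi -> is_derive (fun s => F x s) r (Fr x r);
  nt_G_dx : forall x r : R, lo <= r <= hi -> is_derive (fun t => G t r) x (Gx x r);
  nt_G_dr : forall x r : R, lo <= r <= hi -> is_derive (fun s => G x s) r (Gr x r);
  nt_V_dx : forall x r : R, lo <= r <= hi ->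
    is_derive (fun t => V t r) x (G x r * Fx x r - r);
  nt_V_dr : forall x r : R, lo <= r <= hi ->
    is_derive (fun s => V x s) r (G x r * Fr x r);
  nt_F : forall x r : R, lo <= r <= hi -> Rabs (F x r - x - al r) <= eta;
  nt_G : forall x r : R, lo <= r <= hi -> Rabs (G x r - r) <= eta;
  nt_Fx : forall x r : R, lo <= r <= hi -> Rabs (Fx x r - 1) <= eta;
  nt_Fr : forall x r : R, lo <= r <= hi -> Rabs (Fr x r - dal r) <= eta;
  nt_Gx : forall x r : R, lo <= r <= hi -> Rabs (Gx x r) <= eta;
  nt_Gr : forall x r : R, lo <= r <= hi -> Rabs (Gr x r - 1) <= eta;
  nt_Fx_lip : forall x y r : R, lo <= r <= hi -> Rabs (Fx y r - Fx x r) <= Rabs (y - x);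
  nt_Gx_lip : forall x y r : R, lo <= r <= hi -> Rabs (Gx y r - Gx x r) <= Rabs (y - x);
  nt_F_per : forall x r : R, lo <= r <= hi -> F (x + 2 * PI) r = F x r + 2 * PI;
  nt_G_per : forall x r : R, lo <= r <= hi -> G (x + 2 * PI) r = G x r;
  nt_V_per : forall x r : R, lo <= r <= hi -> V (x + 2 * PI) r = V x r
}.

Definition orbit_pair (F G : R -> R -> R) (lo hi : R) (m1 : nat) (m2 : Z) : Prop :=
  exists u z p s, rot_class m1 u /\ rot_class m1 z /\
    map_orbit F G lo hi m2 u p /\ map_orbit F G lo hi m2 z s /\
    (forall q, p (q + Z.of_nat m1)%Z = p q) /\ (forall q, s (q + Z.of_nat m1)%Z = s q) /\
    (forall q, u q <= z q <= u (q + 1)%Z) /\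
    (exists q, z q <> u q) /\ (exists q, z q <> u (q + 1)%Z).

(** All constants are computed from [al], [dal] and the strip before the rotation type is
    introduced; here the uniformity in the period is settled. *)
Lemma near_twist_orbit_pair_pos (al dal : R -> R) (lo hi r0 c C : R) :
  lo < r0 < hi -> 0 < c ->
  (forall r, lo <= r <= hi -> is_derive al r (dal r)) ->
  (forall r, lo <= r <= hi -> c <= dal r <= C) ->
  exists eta delta, 0 < eta /\ 0 < delta /\
    forall F G V Fx Fr Gx Gr, near_twist al dal lo hi eta F G V Fx Fr Gx Gr ->
    forall m1 m2, (0 < m1)%nat -> Rabs (2 * PI * IZR m2 / INR m1 - al r0) < delta ->
    orbit_pair F G lo hi m1 m2.
Proof.
intros Hr0 Hc Hd Hb. pose proof PI_RGT_0 as HPI.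
assert (HcC : c <= C) by (specialize (Hb r0 ltac:(lra)); lra).
assert (Ha : forall r s, lo <= r -> r <= s -> s <= hi -> c * (s - r) <= al s - al r <= C * (s - r)).
{ intros r s H1 H2 H3. apply (is_derive_increment_between al dal); auto.
  - intros; apply Hd; lra.
  - intros; apply Hb; lra. }
pose (d := Rmin (r0 - lo) (hi - r0) / 2).
assert (Hd0 : 0 < d /\ lo <= r0 - 2 * d /\ r0 + 2 * d <= hi).
{ unfold d, Rmin; destruct Rle_dec; lra. }
destruct Hd0 as [d_pos [d_lo d_hi]]. clearbody d.
(* At distance d from r0 the angular speed differs from [al r0] by at least c d; the perturbation
   and the deviation of the rotation number take at most c d / 4 each. *)
pose (kappa := c * d / 2).
assert (cd : 0 < c * d) by now apply Rmult_lt_0_compat.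
pose (N := Z.to_nat (up (2 * PI / kappa))).
assert (HN : 2 * PI < INR N * kappa).
{ destruct (archimed (2 * PI / kappa)) as [A _].
  assert (0 < 2 * PI / kappa) by (apply Rdiv_lt_0_compat; unfold kappa; lra).
  assert (0 < up (2 * PI / kappa))%Z by (apply lt_IZR; simpl; lra).
  unfold N. rewrite INR_IZR_INZ, Z2Nat.id by lia.
  apply Rmult_lt_reg_r with (/ kappa); [apply Rinv_0_lt_compat; unfold kappa; lra|].
  replace (IZR (up (2 * PI / kappa)) * kappa * / kappa) with (IZR (up (2 * PI / kappa)))
    by (field; unfold kappa; lra).
  exact A. }
(* The summand 1 in [D0] absorbs eta, and that in [B] the deviation of the rotation number from
   [al r0]. *)
pose (D0 := Rabs (al r0) + C * (hi - lo) + 1).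
pose (B := Rabs (al r0) + 1 + 4 * PI).
pose (E := B + D0).
assert (HC0 : 0 <= C * (hi - lo)) by (apply Rmult_le_pos; lra).
assert (HE : 0 <= E) by (pose proof (Rabs_pos (al r0)); unfold E, B, D0; lra).
(* c / 2 keeps the perturbed twist between c / 2 and C + c; the first entry of [t2] gives [eta_C]
   for the latter bound, c d / 4 serves [kappa], and [t3] keeps the drift over N steps below d. *)
pose (t1 := Rmin (/ 4) (c / 2)). pose (t2 := Rmin (/ (1 + 2 * (C + c))) (c * d / 4)).
pose (t3 := d / ((INR N + 1) * (2 * E + 1))).
pose (eta := Rmin (Rmin t1 t2) t3).
assert (Et : eta <= / 4 /\ eta <= c / 2 /\ eta <= / (1 + 2 * (C + c)) /\ eta <= c * d / 4 /\ eta <= t3).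
{ pose proof (Rmin_l (Rmin t1 t2) t3). pose proof (Rmin_r (Rmin t1 t2) t3).
  pose proof (Rmin_l t1 t2). pose proof (Rmin_r t1 t2).
  pose proof (Rmin_l (/ 4) (c / 2)). pose proof (Rmin_r (/ 4) (c / 2)).
  pose proof (Rmin_l (/ (1 + 2 * (C + c))) (c * d / 4)).
  pose proof (Rmin_r (/ (1 + 2 * (C + c))) (c * d / 4)).
  unfold eta. unfold t1, t2 in *. lra. }
assert (HN0 : 0 <= INR N) by apply pos_INR.
assert (HX : 0 < (INR N + 1) * (2 * E + 1)) by (apply Rmult_lt_0_compat; lra).
assert (Ep : 0 < eta).
{ unfold eta, t1, t2. repeat apply Rmin_glb_lt; try lra.
  - apply Rinv_0_lt_compat; lra.
  - now apply Rdiv_lt_0_compat. }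
destruct Et as [E1 [E2 [E3 [E4 E5]]]].
exists eta, (Rmin 1 (c * d / 4)). split; [exact Ep|]. split; [apply Rmin_glb_lt; lra|].
intros F G V Fx Fr Gx Gr NT m1 m2 Hm Hom.
pose proof (Rmin_l 1 (c * d / 4)). pose proof (Rmin_r 1 (c * d / 4)).
assert (Om1 : Rabs (2 * PI * IZR m2 / INR m1 - al r0) < 1) by lra.
assert (Om2 : Rabs (2 * PI * IZR m2 / INR m1 - al r0) < c * d / 4) by lra.
clear Hom. set (om := 2 * PI * IZR m2 / INR m1) in *.
apply Rabs_lt_between in Om2.
destruct NT.
assert (FD : forall x r, lo <= r <= hi -> Rabs (F x r - x) <= D0).
{ intros x r Hr. specialize (nt_F0 x r Hr).
  replace (F x r - x) with ((F x r - x - al r) + (al r0 + (al r - al r0))) by ring.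
  eapply Rle_trans; [apply Rabs_triang|].
  assert (Rabs (al r0 + (al r - al r0)) <= Rabs (al r0) + Rabs (al r - al r0)) by apply Rabs_triang.
  assert (Rabs (al r - al r0) <= C * (hi - lo)).
  { destruct (Rle_lt_dec r0 r).
    - pose proof (Ha r0 r ltac:(lra) ltac:(lra) ltac:(lra)). rewrite Rabs_pos_eq; nra.
    - pose proof (Ha r r0 ltac:(lra) ltac:(lra) ltac:(lra)). rewrite Rabs_left1; nra. }
  unfold D0; lra. }
apply (twist_map_orbit_pair F G V Fx Fr Gx Gr lo hi (c / 2) (C + c) eta)
  with (E := E) (D0 := D0) (B := B) (r0 := r0) (d := d) (kappa := kappa) (N := N);
  try assumption; try lra; try reflexivity.
- intros x r Hr. specialize (nt_Fr0 x r Hr). specialize (Hb r Hr).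
  apply Rabs_le_between in nt_Fr0. lra.
- apply (Rmult_le_compat_r (1 + 2 * (C + c))) in E3; [|lra].
  rewrite Rinv_l in E3 by lra. exact E3.
- fold om. unfold B. pose proof (Rabs_triang (om - al r0) (al r0)) as T.
  replace (om - al r0 + al r0) with om in T by ring. lra.
- intros x r Hr. fold om. unfold kappa. pose proof (nt_F0 x r ltac:(lra)) as A.
  apply Rabs_le_between in A. pose proof (Ha r0 r ltac:(lra) ltac:(lra) ltac:(lra)).
  assert (c * d <= c * (r - r0)) by (apply Rmult_le_compat_l; lra). lra.
- intros x r Hr. fold om. unfold kappa. pose proof (nt_F0 x r ltac:(lra)) as A.
  apply Rabs_le_between in A. pose proof (Ha r r0 ltac:(lra) ltac:(lra) ltac:(lra)).
  assert (c * d <= c * (r0 - r)) by (apply Rmult_le_compat_l; lra). lra.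
- apply Rle_trans with ((INR N + 1) * (2 * E + 1) * eta).
  + rewrite <- Rmult_assoc. apply Rmult_le_compat_r; [lra|]. apply Rmult_le_compat_r; lra.
  + apply (Rmult_le_compat_l ((INR N + 1) * (2 * E + 1))) in E5; [|lra].
    unfold t3 in E5. apply Rle_trans with (1 := E5). right; field. split; lra.
Qed.

Lemma is_derive_comp_opp (f : R -> R) (x l : R) :
  is_derive f (- x) l -> is_derive (fun s => f (- s)) x (- l).
Proof.
intros H. replace (- l) with (- 1 * l) by ring.
apply (is_derive_comp f (fun s => - s) x l (- 1)); [exact H|]. auto_derive; [easy|ring].
Qed.

(* The reflection r -> -r conjugates a twist map to one of the opposite twist and keeps
   angles, hence rotation numbers. *)
Lemma near_twist_reflect (al dal : R -> R) (lo hi eta : R) (F G V Fx Fr Gx Gr : R -> R -> R) :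
  near_twist al dal lo hi eta F G V Fx Fr Gx Gr ->
  near_twist (fun r => al (- r)) (fun r => - dal (- r)) (- hi) (- lo) eta
    (fun x r => F x (- r)) (fun x r => - G x (- r)) (fun x r => - V x (- r))
    (fun x r => Fx x (- r)) (fun x r => - Fr x (- r))
    (fun x r => - Gx x (- r)) (fun x r => Gr x (- r)).
Proof.
intros NT.
assert (HR : forall r, - hi <= r <= - lo -> lo <= - r <= hi) by (intros; lra).
destruct NT; split; intros x r; try (intros Hr; pose proof (HR r Hr) as Hr').
- now apply nt_F_dx0.
- now apply (is_derive_comp_opp (fun s => F x s)), nt_F_dr0.
- apply @is_derive_opp; now apply nt_G_dx0.
- rewrite <- (Ropp_involutive (Gr x (- r))). apply @is_derive_opp.
  now apply (is_derive_comp_opp (fun s => G x s)), nt_G_dr0.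
- replace (- G x (- r) * Fx x (- r) - r) with (- (G x (- r) * Fx x (- r) - - r)) by ring.
  apply @is_derive_opp. now apply nt_V_dx0.
- replace (- G x (- r) * - Fr x (- r)) with (- - (G x (- r) * Fr x (- r))) by ring.
  apply @is_derive_opp. now apply (is_derive_comp_opp (fun s => V x s)), nt_V_dr0.
- now apply nt_F0.
- replace (- G x (- r) - r) with (- (G x (- r) - - r)) by ring. rewrite Rabs_Ropp. now apply nt_G0.
- now apply nt_Fx0.
- replace (- Fr x (- r) - - dal (- r)) with (- (Fr x (- r) - dal (- r))) by ring.
  rewrite Rabs_Ropp. now apply nt_Fr0.
- rewrite Rabs_Ropp. now apply nt_Gx0.
- now apply nt_Gr0.
- intros s Hs. now apply nt_Fx_lip0, HR.
- intros s Hs. match goal with |- Rabs (- ?p - - ?q) <= _ =>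
    replace (- p - - q) with (- (p - q)) by ring end.
  rewrite Rabs_Ropp. now apply nt_Gx_lip0, HR.
- now apply nt_F_per0.
- now rewrite nt_G_per0.
- now rewrite nt_V_per0.
Qed.

Lemma map_orbit_reflect (F G : R -> R -> R) (lo hi : R) m u p :
  map_orbit (fun x r => F x (- r)) (fun x r => - G x (- r)) (- hi) (- lo) m u p ->
  map_orbit F G lo hi m u (fun q => - p q).
Proof.
intros H q. destruct (H q) as [A [B C]]. split; [lra|]. split; [exact B|]. rewrite C; ring.
Qed.

Lemma near_twist_orbit_pair (al dal : R -> R) (lo hi r0 c C : R) :
  lo < r0 < hi -> 0 < c ->
  (forall r, lo <= r <= hi -> is_derive al r (dal r)) ->
  (forall r, lo <= r <= hi -> c <= dal r <= C) \/ (forall r, lo <= r <= hi -> c <= - dal r <= C) ->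
  exists eta delta, 0 < eta /\ 0 < delta /\
    forall F G V Fx Fr Gx Gr, near_twist al dal lo hi eta F G V Fx Fr Gx Gr ->
    forall m1 m2, (0 < m1)%nat -> Rabs (2 * PI * IZR m2 / INR m1 - al r0) < delta ->
    orbit_pair F G lo hi m1 m2.
Proof.
intros Hr0 Hc Hd [Hb|Hb]; [now apply (near_twist_orbit_pair_pos al dal lo hi r0 c C)|].
destruct (near_twist_orbit_pair_pos (fun r => al (- r)) (fun r => - dal (- r)) (- hi) (- lo) (- r0) c C)
  as [eta [delta [He [Hdl H]]]].
- lra.
- exact Hc.
- intros r Hr. apply is_derive_comp_opp, Hd; lra.
- intros r Hr. apply Hb; lra.
- exists eta, delta. split; [exact He|]. split; [exact Hdl|].
  intros F G V Fx Fr Gx Gr NT m1 m2 Hm Hom.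
  apply near_twist_reflect in NT. rewrite Ropp_involutive in H.
  destruct (H _ _ _ _ _ _ _ NT m1 m2 Hm Hom) as [u [z [p [s [Hu [Hz [Op [Os [Pp [Ps Hrest]]]]]]]]]].
  exists u, z, (fun q => - p q), (fun q => - s q).
  split; [exact Hu|]. split; [exact Hz|].
  split; [now apply map_orbit_reflect|]. split; [now apply map_orbit_reflect|].
  split; [intros q; now rewrite Pp|]. split; [intros q; now rewrite Ps|]. exact Hrest.
Qed.

(** * Periodic points of maps of the strip *)

(** Bezout, with the coefficient of m2 reduced modulo m1 to a natural number because orbits are
    followed forward. Thus one orbit and its translates by 2 PI reach every index. *)
Lemma coprime_combination (m1 : nat) (m2 : Z) : (0 < m1)%nat -> Z.gcd (Z.of_nat m1) m2 = 1%Z ->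
  forall q, exists (i : nat) (l : Z), q = (Z.of_nat i * m2 + l * Z.of_nat m1)%Z.
Proof.
intros Hm Hg q.
destruct (Z.gcd_bezout (Z.of_nat m1) m2 1 Hg) as [a [b Hab]].
set (M := Z.of_nat m1) in *. assert (HM : (0 < M)%Z) by lia.
pose proof (Z.mod_pos_bound (q * b) M HM). pose proof (Z.div_mod (q * b) M ltac:(lia)) as Hd.
exists (Z.to_nat ((q * b) mod M)), (q * a + (q * b / M) * m2)%Z.
rewrite Z2Nat.id by lia.
replace ((q * b) mod M)%Z with (q * b - M * (q * b / M))%Z by lia.
transitivity (q * (a * M + b * m2))%Z; [rewrite Hab|]; ring.
Qed.

Section OrbitToPoints.

Variables (F G : R -> R -> R) (M : R * R -> R * R) (a b lo hi : R) (m1 : nat) (m2 : Z).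
Hypothesis M_eq : forall x r, M (x, r) = (F x r, G x r).
Hypothesis a_lo : a <= lo.
Hypothesis hi_b : hi <= b.
Hypothesis m1_pos : (0 < m1)%nat.

Lemma map_orbit_iter u p : map_orbit F G lo hi m2 u p ->
  forall j, iter_map M j (u 0%Z, p 0%Z) = (u (Z.of_nat j * m2)%Z, p (Z.of_nat j * m2)%Z).
Proof.
intros H j; induction j as [|j IH]; [easy|].
cbn [iter_map]. rewrite IH, M_eq. destruct (H (Z.of_nat j * m2)%Z) as [_ [E1 E2]].
rewrite <- E1, <- E2. replace (Z.of_nat (S j) * m2)%Z with (Z.of_nat j * m2 + m2)%Z by lia.
reflexivity.
Qed.

Lemma map_orbit_periodic_point u p : rot_class m1 u -> map_orbit F G lo hi m2 u p ->
  (forall q, p (q + Z.of_nat m1)%Z = p q) ->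
  periodic_point a b M m1 m2 (u 0%Z, p 0%Z).
Proof.
intros Hu H Hp.
assert (S : forall q, in_strip a b (u q, p q)).
{ intros q. destruct (H q) as [A _]. unfold in_strip; simpl; lra. }
split; [apply S|]. split.
- intros j _. rewrite (map_orbit_iter u p H). apply S.
- rewrite (map_orbit_iter u p H).
  replace (Z.of_nat m1 * m2)%Z with (0 + m2 * Z.of_nat m1)%Z by lia.
  now rewrite (rot_class_period m1 u Hu), (Zperiodic_mul p _ Hp).
Qed.

(** A coincidence modulo 2 PI makes [z] agree with a translate of [u] by some t along the orbit,
    hence at every index by coprimality. Since [z] lies between [u] and its next translate, t <= 0
    forces z = u and t >= 1 forces equality with that translate; both are excluded. *)
Lemma map_orbit_distinct u z p s : Z.gcd (Z.of_nat m1) m2 = 1%Z ->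
  rot_class m1 u -> rot_class m1 z ->
  map_orbit F G lo hi m2 u p -> map_orbit F G lo hi m2 z s ->
  (forall q, p (q + Z.of_nat m1)%Z = p q) ->
  (forall q, u q <= z q <= u (q + 1)%Z) ->
  (exists q, z q <> u q) -> (exists q, z q <> u (q + 1)%Z) ->
  distinct_periodic M m1 (u 0%Z, p 0%Z) (z 0%Z, s 0%Z).
Proof.
intros Hg Hu Hz Op Os Pp Hr [q1 N1] [q2 N2] j _ [k [E1 E2]].
rewrite (map_orbit_iter u p Op) in E1, E2. simpl in E1, E2.
(* The index at which [u] takes the value [z 0]: j iterates forward, then k full turns back. *)
pose (t := (Z.of_nat j * m2 + (- k) * Z.of_nat m1)%Z).
assert (I : forall i : nat, u (t + Z.of_nat i * m2)%Z = z (Z.of_nat i * m2)%Z /\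
                            p (t + Z.of_nat i * m2)%Z = s (Z.of_nat i * m2)%Z).
{ intros i; induction i as [|i [IH1 IH2]].
  - replace (t + Z.of_nat 0 * m2)%Z with t by lia. unfold t.
    rewrite (rot_class_period m1 u Hu), (Zperiodic_mul p _ Pp), opp_IZR. simpl. lra.
  - replace (t + Z.of_nat (S i) * m2)%Z with (t + Z.of_nat i * m2 + m2)%Z by lia.
    replace (Z.of_nat (S i) * m2)%Z with (Z.of_nat i * m2 + m2)%Z by lia.
    destruct (Op (t + Z.of_nat i * m2)%Z) as [_ [-> ->]].
    destruct (Os (Z.of_nat i * m2)%Z) as [_ [-> ->]]. now rewrite IH1, IH2. }
assert (T : forall q, u (q + t)%Z = z q).
{ intros q. destruct (coprime_combination m1 m2 m1_pos Hg q) as [i [l ->]].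
  rewrite (rot_class_period m1 z Hz). destruct (I i) as [<- _].
  rewrite <- (rot_class_period m1 u Hu). f_equal; lia. }
destruct (Z_le_gt_dec t 0) as [Ht|Ht].
- apply N1. apply Rle_antisym; [|apply Hr]. rewrite <- T. apply (rot_class_le m1 u Hu); lia.
- apply N2. apply Rle_antisym; [apply Hr|]. rewrite <- T. apply (rot_class_le m1 u Hu); lia.
Qed.

Lemma orbit_pair_periodic_points : Z.gcd (Z.of_nat m1) m2 = 1%Z ->
  orbit_pair F G lo hi m1 m2 ->
  exists p q, periodic_point a b M m1 m2 p /\ periodic_point a b M m1 m2 q /\
    distinct_periodic M m1 p q.
Proof.
intros Hg [u [z [p [s [Hu [Hz [Op [Os [Pp [Ps [Hr [N1 N2]]]]]]]]]]]].
exists (u 0%Z, p 0%Z), (z 0%Z, s 0%Z).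
split; [now apply map_orbit_periodic_point|].
split; [now apply map_orbit_periodic_point|].
now apply map_orbit_distinct.
Qed.

End OrbitToPoints.

(** * From the regularity hypotheses to [near_twist] *)

Lemma Ck_strip_is_derive (k : nat) (a b : R) (f : R -> R -> R) (w : list bool) (x r : R) :
  Ck_strip k a b f -> (length w < k)%nat -> a < r < b ->
  is_derive (fun t => pd w f t r) x (pd (false :: w) f x r) /\
  is_derive (fun s => pd w f x s) r (pd (true :: w) f x r).
Proof.
intros [H _] Hw Hr. split.
- apply Derive_correct. exact (H w false Hw (x, r) Hr).
- apply Derive_correct. exact (H w true Hw (x, r) Hr).
Qed.

Lemma Ck_norm_ge (k : nat) (a b : R) (f : R -> R -> R) w x r :
  (length w <= k)%nat -> a < r < b -> Rbar_le (Rabs (pd w f x r)) (Ck_norm k a b f).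
Proof.
intros Hw Hr. apply (proj1 (Lub_Rbar_correct _)).
exists w, (x, r). split; [exact Hw|]. split; [exact Hr | reflexivity].
Qed.

(** Each norm dominates an absolute value and so is not [m_infty]; the default value of [Rbar_plus]
    on opposite infinities cannot occur. *)
Lemma Ck_norm_plus_bound (k : nat) (a b eta : R) (f g : R -> R -> R) w x r :
  Rbar_le (Rbar_plus (Ck_norm k a b f) (Ck_norm k a b g)) eta ->
  (length w <= k)%nat -> a < r < b ->
  Rabs (pd w f x r) <= eta /\ Rabs (pd w g x r) <= eta.
Proof.
intros H Hw Hr.
pose proof (Ck_norm_ge k a b f w x r Hw Hr) as Hf.
pose proof (Ck_norm_ge k a b g w x r Hw Hr) as Hg.
pose proof (Rabs_pos (pd w f x r)). pose proof (Rabs_pos (pd w g x r)).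
destruct (Ck_norm k a b f) as [nf| |], (Ck_norm k a b g) as [ng| |]; simpl in *; try easy; lra.
Qed.

Lemma is_derive_minus_const (f : R -> R) (x l k : R) :
  is_derive f x l -> is_derive (fun t => f t - k) x l.
Proof.
intros H. replace l with (l - 0) by ring.
apply @is_derive_minus; [exact H | apply @is_derive_const].
Qed.

Section StripMap.

Variables (a b : R) (al : R -> R) (mu1 mu2 : R -> R -> R -> R).
Hypothesis mu_zero : forall t r, a <= r <= b -> mu1 0 t r = 0 /\ mu2 0 t r = 0.

Notation angle eps := (fun t r => fst (Mmap al mu1 mu2 eps (t, r))).
Notation radius eps := (fun t r => snd (Mmap al mu1 mu2 eps (t, r))).

Hypothesis angle0_Ck : Ck_strip 4 a b (angle 0).

(** At eps = 0 the angle component is t + alpha r, so alpha inherits its regularity from the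
    unperturbed map. *)
Lemma alpha_is_derive_pd r t : a < r < b -> is_derive al r (pd (true :: nil) (angle 0) t r).
Proof.
intros Hr.
destruct (Ck_strip_is_derive 4 a b (angle 0) nil t r angle0_Ck ltac:(simpl; lia) Hr) as [_ H].
set (l := pd (true :: nil) (angle 0) t r) in *.
(* The identity holds only for radii in [a, b], hence the local form of extensionality. *)
apply (is_derive_ext_loc (fun s => pd nil (angle 0) t s - t)).
- assert (P : 0 < Rmin (r - a) (b - r)) by (apply Rmin_glb_lt; lra).
  exists (mkposreal _ P). intros s Hs. change (Rabs (s - r) < Rmin (r - a) (b - r)) in Hs.
  apply Rabs_lt_between in Hs. pose proof (Rmin_l (r - a) (b - r)). pose proof (Rmin_r (r - a) (b - r)).
  simpl. rewrite (proj1 (mu_zero t s ltac:(lra))). ring.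
- exact (is_derive_minus_const _ r _ t H).
Qed.

Lemma alpha_is_derive r : a < r < b -> is_derive al r (Derive al r).
Proof. intros Hr. apply Derive_correct. eexists. now apply (alpha_is_derive_pd r 0). Qed.

Lemma alpha_derive_continuous r0 eps : a < r0 < b -> 0 < eps ->
  exists d, 0 < d /\ forall r, Rabs (r - r0) < d -> a < r < b /\ Rabs (Derive al r - Derive al r0) < eps.
Proof.
intros Hr0 He. destruct angle0_Ck as [_ H].
destruct (H (true :: nil) ltac:(simpl; lia)) as [g [Hg [_ Hc]]].
assert (Eg : forall r, a < r < b -> g (0, r) = Derive al r).
{ intros r Hr. rewrite Hg by exact Hr. symmetry. apply is_derive_unique. now apply (alpha_is_derive_pd r 0). }
assert (S0 : in_strip a b (0, r0)) by (unfold in_strip; simpl; lra).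
specialize (Hc (0, r0) S0 (fun y => ball (g (0, r0)) (mkposreal eps He) y) (locally_ball _ _)).
destruct Hc as [d Hd].
assert (P : 0 < Rmin d (Rmin (r0 - a) (b - r0))) by (repeat apply Rmin_glb_lt; try lra; apply cond_pos).
exists (Rmin d (Rmin (r0 - a) (b - r0))). split; [exact P|]. intros r Hr.
pose proof (Rmin_l d (Rmin (r0 - a) (b - r0))). pose proof (Rmin_r d (Rmin (r0 - a) (b - r0))).
pose proof (Rmin_l (r0 - a) (b - r0)). pose proof (Rmin_r (r0 - a) (b - r0)).
pose proof (Rabs_lt_between (r - r0) (Rmin d (Rmin (r0 - a) (b - r0)))) as [Bt _]. specialize (Bt Hr).
assert (Hr' : a < r < b) by lra. split; [exact Hr'|].
rewrite <- !Eg by assumption.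
apply (Hd (0, r)).
- split; [apply ball_center|]. change (Rabs (r - r0) < d). lra.
- unfold in_strip; simpl; lra.
Qed.

Variables (eps eta lo hi : R) (V : R -> R -> R).
Hypothesis lo_in : a < lo.
Hypothesis hi_in : hi < b.
Hypothesis eta_le1 : eta <= 1.
Hypothesis angle_Ck : Ck_strip 4 a b (angle eps).
Hypothesis radius_Ck : Ck_strip 4 a b (radius eps).
Hypothesis mu_per : forall t r, a <= r <= b ->
  mu1 eps (t + 2 * PI) r = mu1 eps t r /\ mu2 eps (t + 2 * PI) r = mu2 eps t r.
Hypothesis V_Ck : Ck_strip 4 a b V.
Hypothesis V_per : forall t r, a <= r <= b -> V (t + 2 * PI) r = V t r.
Hypothesis V_exact : forall t r, a < r < b ->
  pd (false :: nil) V t r = radius eps t r * pd (false :: nil) (angle eps) t r - r /\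
  pd (true :: nil) V t r = radius eps t r * pd (true :: nil) (angle eps) t r.
Hypothesis mu_small :
  Rbar_le (Rbar_plus (Ck_norm 4 a b (mu1 eps)) (Ck_norm 4 a b (mu2 eps))) eta.

Lemma Mmap_near_twist :
  near_twist al (Derive al) lo hi eta (angle eps) (radius eps) V
    (pd (false :: nil) (angle eps)) (pd (true :: nil) (angle eps))
    (pd (false :: nil) (radius eps)) (pd (true :: nil) (radius eps)).
Proof.
assert (In : forall r, lo <= r <= hi -> a < r < b) by (intros; lra).
assert (In' : forall r, lo <= r <= hi -> a <= r <= b) by (intros; lra).
assert (B : forall w x r, (length w <= 4)%nat -> lo <= r <= hi ->
   Rabs (pd w (mu1 eps) x r) <= eta /\ Rabs (pd w (mu2 eps) x r) <= eta).
{ intros w x r Hw Hr. apply (Ck_norm_plus_bound 4 a b); auto. }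
pose proof (fun x r Hr => Ck_strip_is_derive 4 a b _ nil x r angle_Ck ltac:(simpl; lia) (In r Hr)) as DF.
pose proof (fun x r Hr => Ck_strip_is_derive 4 a b _ nil x r radius_Ck ltac:(simpl; lia) (In r Hr)) as DG.
pose proof (fun x r Hr => Ck_strip_is_derive 4 a b _ nil x r V_Ck ltac:(simpl; lia) (In r Hr)) as DV.
pose proof (fun x r Hr => Ck_strip_is_derive 4 a b _ (false :: nil) x r angle_Ck ltac:(simpl; lia) (In r Hr)) as DFx.
pose proof (fun x r Hr => Ck_strip_is_derive 4 a b _ (false :: nil) x r radius_Ck ltac:(simpl; lia) (In r Hr)) as DGx.
assert (F1 : forall x r, lo <= r <= hi ->
   pd (false :: nil) (mu1 eps) x r = pd (false :: nil) (angle eps) x r - 1).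
{ intros x r Hr. apply is_derive_unique.
  apply (is_derive_ext (fun t => pd nil (angle eps) t r - (t + al r))).
  - intros t; simpl; ring.
  - apply @is_derive_minus; [exact (proj1 (DF x r Hr))|]. auto_derive; [easy|ring]. }
assert (F2 : forall x r, lo <= r <= hi ->
   pd (true :: nil) (mu1 eps) x r = pd (true :: nil) (angle eps) x r - Derive al r).
{ intros x r Hr. apply is_derive_unique.
  apply (is_derive_ext (fun s => pd nil (angle eps) x s - (x + al s))).
  - intros t; simpl; ring.
  - apply @is_derive_minus; [exact (proj2 (DF x r Hr))|].
    replace (Derive al r) with (0 + Derive al r) by ring.
    apply @is_derive_plus; [apply @is_derive_const | now apply alpha_is_derive, In]. }
assert (G1 : forall x r, lo <= r <= hi ->
   pd (false :: nil) (mu2 eps) x r = pd (false :: nil) (radius eps) x r).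
{ intros x r Hr. apply is_derive_unique.
  apply (is_derive_ext (fun t => pd nil (radius eps) t r - r)).
  - intros t; simpl; ring.
  - exact (is_derive_minus_const _ x _ r (proj1 (DG x r Hr))). }
assert (G2 : forall x r, lo <= r <= hi ->
   pd (true :: nil) (mu2 eps) x r = pd (true :: nil) (radius eps) x r - 1).
{ intros x r Hr. apply is_derive_unique.
  apply (is_derive_ext (fun s => pd nil (radius eps) x s - s)).
  - intros t; simpl; ring.
  - apply @is_derive_minus; [exact (proj2 (DG x r Hr)) | apply @is_derive_id]. }
assert (F3 : forall x r, lo <= r <= hi ->
   pd (false :: false :: nil) (mu1 eps) x r = pd (false :: false :: nil) (angle eps) x r).
{ intros x r Hr. apply is_derive_unique.
  apply (is_derive_ext (fun t => pd (false :: nil) (angle eps) t r - 1)).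
  - intros t. symmetry. now apply F1.
  - exact (is_derive_minus_const _ x _ 1 (proj1 (DFx x r Hr))). }
assert (G3 : forall x r, lo <= r <= hi ->
   pd (false :: false :: nil) (mu2 eps) x r = pd (false :: false :: nil) (radius eps) x r).
{ intros x r Hr. apply is_derive_unique.
  apply (is_derive_ext (fun t => pd (false :: nil) (radius eps) t r)).
  - intros t. symmetry. now apply G1.
  - exact (proj1 (DGx x r Hr)). }
split.
- intros x r Hr. exact (proj1 (DF x r Hr)).
- intros x r Hr. exact (proj2 (DF x r Hr)).
- intros x r Hr. exact (proj1 (DG x r Hr)).
- intros x r Hr. exact (proj2 (DG x r Hr)).
- intros x r Hr. rewrite <- (proj1 (V_exact x r (In r Hr))). exact (proj1 (DV x r Hr)).
- intros x r Hr. rewrite <- (proj2 (V_exact x r (In r Hr))). exact (proj2 (DV x r Hr)).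
- intros x r Hr. destruct (B nil x r ltac:(simpl; lia) Hr) as [A _]. simpl in A |- *.
  now replace (x + al r + mu1 eps x r - x - al r) with (mu1 eps x r) by ring.
- intros x r Hr. destruct (B nil x r ltac:(simpl; lia) Hr) as [_ A]. simpl in A |- *.
  now replace (r + mu2 eps x r - r) with (mu2 eps x r) by ring.
- intros x r Hr. rewrite <- F1 by exact Hr. apply B; [simpl; lia | exact Hr].
- intros x r Hr. rewrite <- F2 by exact Hr. apply B; [simpl; lia | exact Hr].
- intros x r Hr. rewrite <- G1 by exact Hr. apply B; [simpl; lia | exact Hr].
- intros x r Hr. rewrite <- G2 by exact Hr. apply B; [simpl; lia | exact Hr].
- intros x y r Hr. rewrite <- (Rmult_1_l (Rabs (y - x))).
  apply (is_derive_increment_Rabs (fun t => pd (false :: nil) (angle eps) t r)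
           (fun t => pd (false :: false :: nil) (angle eps) t r)).
  + intros s _. exact (proj1 (DFx s r Hr)).
  + intros s _. rewrite <- F3 by exact Hr. apply Rle_trans with eta; [|exact eta_le1].
    apply B; [simpl; lia | exact Hr].
- intros x y r Hr. rewrite <- (Rmult_1_l (Rabs (y - x))).
  apply (is_derive_increment_Rabs (fun t => pd (false :: nil) (radius eps) t r)
           (fun t => pd (false :: false :: nil) (radius eps) t r)).
  + intros s _. exact (proj1 (DGx s r Hr)).
  + intros s _. rewrite <- G3 by exact Hr. apply Rle_trans with eta; [|exact eta_le1].
    apply B; [simpl; lia | exact Hr].
- intros x r Hr. simpl. rewrite (proj1 (mu_per x r (In' r Hr))). ring.
- intros x r Hr. simpl. now rewrite (proj2 (mu_per x r (In' r Hr))).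
- intros x r Hr. now apply V_per, In'.
Qed.

End StripMap.

Lemma near_twist_weaken al dal lo hi eta eta' F G V Fx Fr Gx Gr : eta' <= eta ->
  near_twist al dal lo hi eta' F G V Fx Fr Gx Gr -> near_twist al dal lo hi eta F G V Fx Fr Gx Gr.
Proof.
intros He NT; destruct NT; split; auto; intros x r Hr; apply Rle_trans with (2 := He); auto.
Qed.

Theorem theorem2p1 (a b epsbar : R) (alpha : R -> R) (mu1 mu2 : R -> R -> R -> R)
  (rstar : R) (n1 n2 : Z) :
  a < b -> 0 < epsbar ->
  (* regularity, injectivity, periodicity, vanishing at eps = 0 *)
  (forall eps, Rabs eps <= epsbar ->
     Ck_strip 4 a b (fun t r => fst (Mmap alpha mu1 mu2 eps (t, r))) /\
     Ck_strip 4 a b (fun t r => snd (Mmap alpha mu1 mu2 eps (t, r))) /\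
     (forall p q, in_strip a b p -> in_strip a b q ->
        Mmap alpha mu1 mu2 eps p = Mmap alpha mu1 mu2 eps q -> p = q) /\
     (forall t r, a <= r <= b ->
        mu1 eps (t + 2 * PI) r = mu1 eps t r /\ mu2 eps (t + 2 * PI) r = mu2 eps t r)) ->
  (forall t r, a <= r <= b -> mu1 0 t r = 0 /\ mu2 0 t r = 0) ->
  (* exact symplecticity: dV = M^* (r dtheta) - r dtheta *)
  (forall eps, Rabs eps <= epsbar ->
     exists V : R -> R -> R,
       Ck_strip 4 a b V /\
       (forall t r, a <= r <= b -> V (t + 2 * PI) r = V t r) /\
       (forall t r, a < r < b ->
          pd (false :: nil) V t r =
            snd (Mmap alpha mu1 mu2 eps (t, r)) *
              pd (false :: nil) (fun t' r' => fst (Mmap alpha mu1 mu2 eps (t', r'))) t r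
            - r /\
          pd (true :: nil) V t r =
            snd (Mmap alpha mu1 mu2 eps (t, r)) *
              pd (true :: nil) (fun t' r' => fst (Mmap alpha mu1 mu2 eps (t', r'))) t r)) ->
  (* C^4 norms of mu1, mu2 tend to 0 as eps -> 0 *)
  (forall eta, 0 < eta -> exists delta, 0 < delta /\
     forall eps, Rabs eps <= epsbar -> Rabs eps < delta ->
       Rbar_le (Rbar_plus (Ck_norm 4 a b (mu1 eps)) (Ck_norm 4 a b (mu2 eps))) eta) ->
  a < rstar < b ->
  (0 < n1)%Z -> Z.gcd n1 n2 = 1%Z ->
  alpha rstar = 2 * PI * IZR n2 / IZR n1 ->
  Derive alpha rstar <> 0 ->
  exists epsstar deltastar, 0 < epsstar /\ epsstar <= epsbar /\ 0 < deltastar /\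
    forall (m1 : nat) (m2 : Z) (eps : R),
      (0 < m1)%nat -> Z.gcd (Z.of_nat m1) m2 = 1%Z ->
      Rabs (IZR m2 / INR m1 - IZR n2 / IZR n1) < deltastar ->
      Rabs eps < epsstar ->
      exists p q,
        periodic_point a b (Mmap alpha mu1 mu2 eps) m1 m2 p /\
        periodic_point a b (Mmap alpha mu1 mu2 eps) m1 m2 q /\
        distinct_periodic (Mmap alpha mu1 mu2 eps) m1 p q.
Proof.
intros _ Heb Hreg Hmu0 Hex Hnorm Hrs Hn1 _ Hal Hdal.
pose proof PI_RGT_0 as HPI.
assert (HF0 : Ck_strip 4 a b (fun t r => fst (Mmap alpha mu1 mu2 0 (t, r)))).
{ refine (proj1 (Hreg 0 _)). rewrite Rabs_R0; lra. }
assert (Hc : 0 < Rabs (Derive alpha rstar) / 2) by (pose proof (Rabs_pos_lt _ Hdal); lra).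
destruct (alpha_derive_continuous a b alpha mu1 mu2 Hmu0 HF0 rstar _ Hrs Hc) as [d [Hd Hcont]].
set (c := Rabs (Derive alpha rstar) / 2) in *.
assert (Hin : forall r, rstar - d / 2 <= r <= rstar + d / 2 ->
   a < r < b /\ Rabs (Derive alpha r - Derive alpha rstar) < c).
{ intros r Hr. apply Hcont. apply Rabs_lt_between; lra. }
destruct (near_twist_orbit_pair alpha (Derive alpha) (rstar - d / 2) (rstar + d / 2) rstar c (3 * c))
  as [eta [delta [Heta [Hdelta Hcore]]]].
- lra.
- exact Hc.
- intros r Hr. apply (alpha_is_derive a b alpha mu1 mu2 Hmu0 HF0). now apply Hin.
- destruct (Rle_lt_dec 0 (Derive alpha rstar)) as [L|L]; [left|right]; intros r Hr;
    destruct (Hin r Hr) as [_ A]; apply Rabs_lt_between in A;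
    assert (Ec : 2 * c = Rabs (Derive alpha rstar)) by (unfold c; field).
  + rewrite Rabs_pos_eq in Ec by lra; lra.
  + rewrite Rabs_left in Ec by lra; lra.
- destruct (Hnorm (Rmin eta 1)) as [de [Hde Hsmall]]; [apply Rmin_glb_lt; lra|].
  exists (Rmin de epsbar), (delta / (2 * PI)).
  split; [apply Rmin_glb_lt; lra|]. split; [apply Rmin_r|].
  split; [apply Rdiv_lt_0_compat; lra|].
  intros m1 m2 eps Hm Hg Hrot Heps.
  pose proof (Rmin_l de epsbar). pose proof (Rmin_r de epsbar).
  assert (Heps' : Rabs eps <= epsbar) by lra.
  destruct (Hreg eps Heps') as [RF [RG [_ Rper]]].
  destruct (Hex eps Heps') as [V [VC [Vper Vex]]].
  assert (NT := Mmap_near_twist a b alpha mu1 mu2 Hmu0 HF0 eps (Rmin eta 1)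
     (rstar - d / 2) (rstar + d / 2) V ltac:(apply Hin; lra) ltac:(apply Hin; lra) (Rmin_r _ _)
     RF RG Rper VC Vper Vex (Hsmall eps Heps' ltac:(lra))).
  apply (near_twist_weaken _ _ _ _ eta) in NT; [|apply Rmin_l].
  assert (Hrot' : Rabs (2 * PI * IZR m2 / INR m1 - alpha rstar) < delta).
  { rewrite Hal.
    replace (2 * PI * IZR m2 / INR m1 - 2 * PI * IZR n2 / IZR n1)
      with (2 * PI * (IZR m2 / INR m1 - IZR n2 / IZR n1))
      by (field; split; [apply eq_IZR_contrapositive; lia | apply not_0_INR; lia]).
    rewrite Rabs_mult, (Rabs_pos_eq (2 * PI)) by lra.
    apply (Rmult_lt_compat_l (2 * PI)) in Hrot; [|lra].
    apply Rlt_le_trans with (1 := Hrot). right; field; lra. }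
  pose proof (Hcore _ _ _ _ _ _ _ NT m1 m2 Hm Hrot') as OP.
  refine (orbit_pair_periodic_points _ _ _ a b _ _ m1 m2 _ _ _ Hm Hg OP).
  + intros x r. reflexivity.
  + left; apply Hin; lra.
  + left; apply Hin; lra.
Qed.
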